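(* Let $K\ge 1$, $t\in[0,1]$ and $m\in\mathbb{N}$. Let $R_{K,m,t}$ be the unique root in $(0,1)$ of the equation $$D^t_{K,m}(r):=\frac{tr^m}{1-r^m}+\frac{2(1-t)Kr}{(K+1)(1-r)}-\frac12=0 .$$ Suppose that $f(z)=h(z)+\overline{g(z)}=\sum_{n=0}^{\infty}a_nz^n+\overline{\sum_{n=1}^{\infty}b_nz^n}$ is a sense-preserving $K$-quasiconformal harmonic mapping in $\mathbb{D}$ and $h\prec\phi$, where $\phi$ is a convex function in $\mathbb{D}$. Then (with $b_0=0$) $$t|h(z^m)|+(1-t)\sum_{n=0}^{\infty}(|a_n|+|b_n|)r^n\le|\phi(0)|+d(\phi(0),\partial\phi(\mathbb{D}))$$ for $|z|=r\le\min\{1/3,R_{K,m,t}\}$. Moreover, if $R_{K,m,t}\le 1/3$, the radius $R_{K,m,t}$ is sharp, i.e. it cannot be replaced by any larger number in this statement (over all admissible $f$ and $\phi$).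
   Context: $\mathbb{D}=\{z\in\mathbb{C}:|z|<1\}$. A convex function in $\mathbb{D}$ is an analytic univalent function $\phi$ on $\mathbb{D}$ whose image $\phi(\mathbb{D})$ is a convex set. $d(\phi(0),\partial\phi(\mathbb{D}))$ is the Euclidean distance from $\phi(0)$ to the boundary of $\phi(\mathbb{D})$. For analytic $h,\phi$ in $\mathbb{D}$, $h\prec\phi$ ($h$ is subordinate to $\phi$) means $h=\phi\circ w$ for some analytic $w:\mathbb{D}\to\mathbb{D}$ with $w(0)=0$. A harmonic mapping $f=h+\overline g$ in $\mathbb{D}$ ($h,g$ analytic) is sense-preserving $K$-quasiconformal if it is locally univalent and sense-preserving (i.e. $h'\ne0$ and $|\omega|<1$ in $\mathbb{D}$, where $\omega=g'/h'$) and $|\omega(z)|\le k<1$ in $\mathbb{D}$, where $K=(1+k)/(1-k)\ge1$, i.e. $k=(K-1)/(K+1)$. *)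

(* Defs.v *)
From Stdlib Require Import Reals.
From Coquelicot Require Import Coquelicot.
Open Scope R_scope.

Definition unit_disk (z : C) : Prop := Cmod z < 1.

(* Complex differentiability at every point of the unit disk; the values of a
   function outside the disk are irrelevant in everything below. *)
Definition analytic (f : C -> C) : Prop :=
  forall z : C, unit_disk z -> @ex_derive C_AbsRing C_NormedModule f z.

Definition univalent (f : C -> C) : Prop :=
  forall z1 z2 : C, unit_disk z1 -> unit_disk z2 -> f z1 = f z2 -> z1 = z2.

Definition disk_image (f : C -> C) (p : C) : Prop :=
  exists z : C, unit_disk z /\ p = f z.

Definition convex_set (S : C -> Prop) : Prop :=
  forall (p q : C) (s : R), S p -> S q -> 0 <= s <= 1 ->
    S (RtoC (1 - s) * p + RtoC s * q)%C.

Definition convex_function (phi : C -> C) : Prop :=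
  analytic phi /\ univalent phi /\ convex_set (disk_image phi).

Definition boundary (S : C -> Prop) (p : C) : Prop :=
  forall eps : R, 0 < eps ->
    (exists q : C, S q /\ Cmod (q - p)%C < eps) /\
    (exists q : C, ~ S q /\ Cmod (q - p)%C < eps).

(* Infimum in the extended reals, so that the distance to the empty set is
   [p_infty] rather than the 0 given by the coercion [real]. *)
Definition distance_to (p : C) (S : C -> Prop) : Rbar :=
  Glb_Rbar (fun x : R => exists q : C, S q /\ x = Cmod (p - q)%C).

Definition subordinate (h phi : C -> C) : Prop :=
  exists w : C -> C,
    analytic w /\
    (forall z : C, unit_disk z -> unit_disk (w z)) /\
    w (RtoC 0) = RtoC 0 /\
    (forall z : C, unit_disk z -> h z = phi (w z)).

Definition harmonic_mapping (f h g : C -> C) : Prop :=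
  analytic h /\ analytic g /\
  (forall z : C, unit_disk z -> f z = (h z + Cconj (g z))%C).

Definition dilatation (h g : C -> C) (z : C) : C :=
  (C_derive g z / C_derive h z)%C.

Definition locally_univalent_sense_preserving (h g : C -> C) : Prop :=
  forall z : C, unit_disk z ->
    C_derive h z <> RtoC 0 /\ Cmod (dilatation h g z) < 1.

(* The bound (K - 1) / (K + 1) is the k with K = (1 + k) / (1 - k). *)
Definition sense_preserving_quasiconformal (K : R) (f h g : C -> C) : Prop :=
  harmonic_mapping f h g /\
  locally_univalent_sense_preserving h g /\
  (forall z : C, unit_disk z ->
     Cmod (dilatation h g z) <= (K - 1) / (K + 1)).

Definition power_series_on_disk (h : C -> C) (a : nat -> C) : Prop :=
  forall z : C, unit_disk z ->
    @is_pseries C_AbsRing C_NormedModule a z (h z).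

Definition D_fun (K t : R) (m : nat) (r : R) : R :=
  t * r ^ m / (1 - r ^ m) + 2 * (1 - t) * K * r / ((K + 1) * (1 - r)) - 1 / 2.

Definition D_root (K t : R) (m : nat) (r : R) : Prop :=
  0 < r < 1 /\ D_fun K t m r = 0.

(* [Cmod z < 1] only matters for [rho >= 1]; for [z] in the disk the series
   below converges, since both power series converge absolutely there. *)
Definition bohr_inequality_up_to (K t : R) (m : nat) (rho : R) : Prop :=
  forall (f h g phi : C -> C) (a b : nat -> C),
    sense_preserving_quasiconformal K f h g ->
    power_series_on_disk h a ->
    power_series_on_disk g b ->
    b 0%nat = RtoC 0 ->
    convex_function phi ->
    subordinate h phi ->
    forall (z : C) (r : R), unit_disk z -> Cmod z = r -> r <= rho ->
      Rbar_le
        (Finite (t * Cmod (h (z ^ m)%C) +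
                 (1 - t) * Series (fun n => (Cmod (a n) + Cmod (b n)) * r ^ n)))
        (Rbar_plus (Finite (Cmod (phi (RtoC 0))))
                   (distance_to (phi (RtoC 0)) (boundary (disk_image phi)))).

(* Main.v *)
Require Import Defs.
From Stdlib Require Import Reals Lra Lia Ranalysis5.
From Coquelicot Require Import Coquelicot.
Open Scope R_scope.

(** Fix a boundary point [q] of the convex set [phi(D)], put [d = |phi(0) - q|] and
    [k = (K - 1) / (K + 1)], so that [1 + k = 2 K / (K + 1)].

    A convex set lies in a half-plane bounded by a line through [q]
    ([convex_separation]), and [h = phi o w] takes its values in [phi(D)].  So, up to a
    rotation, the real part of [h - phi(0)] is at most [d], and the coefficient bound for
    functions with bounded real part ([real_part_coefficient_bound]) gives [|a_n| <= 2 d]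
    for all [n >= 1].

    The dilatation bound says [|g'| <= k |h'|] on the disk.  Parseval on the circle of
    radius [sqrt r] turns it into
    [sum n^2 |b_n|^2 r^(n-1) <= k^2 sum n^2 |a_n|^2 r^(n-1)], and two integrations in [r]
    remove the weights [n^2] ([l2_comparison]).  Hence
    [sum |b_n|^2 r^n <= (2 k d)^2 r / (1 - r)], and by the Cauchy-Schwarz inequality
    [sum |b_n| r^n <= 2 k d r / (1 - r)] ([Series_le_of_l2]).

    Adding up the geometric majorants, the left-hand side of the Bohr inequality is at most
    [|phi(0)| + d + 2 d D(r)] ([bohr_bound]).  As [D] increases from [-1/2] and vanishes at
    the radius [R], this is at most [|phi(0)| + d] when [r <= R]; the infimum over [q] gives
    the claim.  For [h = phi = 1 / (1 - z)] and [g = k z / (1 - z)] all these estimates are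
    equalities with [d = 1/2], so the inequality fails as soon as [D(r) > 0]
    ([bohr_inequality_sharp]).

    Parseval is obtained from means over roots of unity: for a polynomial of degree at most
    [n] the mean of [|P|^2] over the [n + 1]-st roots of unity is exactly the sum of the
    squared moduli of the coefficients, and the tail of an absolutely convergent series is
    uniformly small on the circle. *)

(** * Complex and real series *)

Notation is_Cseries := (@is_series C_AbsRing C_NormedModule).

Ltac cring := match goal with |- ?x = ?y => change (@eq C x y) end; ring.

Lemma is_Cseries_plus (u v : nat -> C) (lu lv : C) :
  is_Cseries u lu -> is_Cseries v lv -> is_Cseries (fun n => u n + v n)%C (lu + lv)%C.
Proof. exact (@is_series_plus C_AbsRing C_NormedModule u v lu lv). Qed.

Lemma is_Cseries_minus (u v : nat -> C) (lu lv : C) :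
  is_Cseries u lu -> is_Cseries v lv -> is_Cseries (fun n => u n - v n)%C (lu - lv)%C.
Proof. exact (@is_series_minus C_AbsRing C_NormedModule u v lu lv). Qed.

Lemma is_Cseries_mult_l (c : C) (u : nat -> C) (l : C) :
  is_Cseries u l -> is_Cseries (fun n => c * u n)%C (c * l)%C.
Proof. exact (@is_series_scal C_AbsRing C_NormedModule c u l). Qed.

Lemma sum_n_Cmult_l (c : C) (u : nat -> C) (n : nat) :
  sum_n (fun i => c * u i)%C n = (c * sum_n u n)%C.
Proof. exact (@sum_n_mult_l C_Ring c u n). Qed.

Lemma sum_n_Re (u : nat -> C) (n : nat) :
  Re (sum_n u n) = sum_n (fun i => Re (u i)) n.
Proof.
  induction n as [|n IH]; [now rewrite !sum_O|].
  rewrite !sum_Sn, <- IH. reflexivity.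
Qed.

Lemma sum_n_Rle (a b : nat -> R) (n : nat) :
  (forall i, a i <= b i) -> sum_n a n <= sum_n b n.
Proof.
  intros H. induction n as [|n IH]; [rewrite !sum_O; apply H|].
  rewrite !sum_Sn. apply Rplus_le_compat; auto.
Qed.

Lemma is_series_single {K : AbsRing} {V : NormedModule K} (k : nat) (c : V) :
  is_series (fun l => if Nat.eqb l k then c else zero) c.
Proof.
  assert (H0 : forall n, (n < k)%nat ->
    sum_n (fun l => if Nat.eqb l k then c else zero) n = zero).
  { induction n as [|n IH]; intros Hn.
    - rewrite sum_O. destruct (Nat.eqb_spec 0 k); [lia|reflexivity].
    - rewrite sum_Sn, IH by lia. destruct (Nat.eqb_spec (S n) k); [lia|].
      apply plus_zero_r. }
  assert (H1 : forall n, (k <= n)%nat ->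
    sum_n (fun l => if Nat.eqb l k then c else zero) n = c).
  { intros n Hn. induction Hn as [|n Hn IH].
    - destruct k as [|k]; [now rewrite sum_O|].
      rewrite sum_Sn, H0 by lia. rewrite Nat.eqb_refl. apply plus_zero_l.
    - rewrite sum_Sn, IH. destruct (Nat.eqb_spec (S n) k); [lia|].
      apply plus_zero_r. }
  apply (filterlim_ext_loc (fun _ => c)).
  - exists k. intros n Hn. symmetry. now apply H1.
  - apply filterlim_const.
Qed.

Lemma is_series_Cmod (u : nat -> C) (l : C) :
  is_Cseries u l <->
  forall eps : R, 0 < eps ->
    exists N, forall n, (N <= n)%nat -> Cmod (sum_n u n - l)%C < eps.
Proof.
  split.
  - intros H eps Heps.
    pose proof (proj1 (@filterlim_locally_ball_norm C_AbsRing nat C_NormedModule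
      eventually _ _ _) H (mkposreal eps Heps)) as [N HN].
    exists N. exact HN.
  - intros H. apply filterlim_locally_ball_norm. intros [eps Heps].
    destruct (H eps Heps) as [N HN]. exists N. intros n Hn.
    exact (HN n Hn).
Qed.

Lemma sum_n_le_Series (a : nat -> R) (n : nat) :
  (forall i, 0 <= a i) -> ex_series a -> sum_n a n <= Series a.
Proof.
  intros Ha Hex.
  rewrite (Series_incr_n a (S n)) by (auto; lia).
  simpl pred. rewrite sum_n_Reals.
  assert (0 <= Series (fun k => a (S n + k)%nat)); [|lra].
  rewrite <- (Rmult_0_l (Series (fun k => a (S n + k)%nat))), <- Series_scal_l.
  apply Series_le.
  - intros i. specialize (Ha (S n + i)%nat). lra.
  - now apply (ex_series_incr_n a (S n)).
Qed.

Lemma term_le_Series (c : nat -> R) (n : nat) :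
  (forall i, 0 <= c i) -> ex_series c -> c n <= Series c.
Proof.
  intros Hc Hex. apply Rle_trans with (sum_n c n); [|now apply sum_n_le_Series].
  destruct n as [|n]; [rewrite sum_O; lra|].
  rewrite sum_Sn. change (c (S n) <= sum_n c n + c (S n)).
  assert (0 <= sum_n c n); [|lra].
  induction n as [|n IH]; [rewrite sum_O; apply Hc|].
  rewrite sum_Sn. apply Rplus_le_le_0_compat; auto.
Qed.

Lemma is_series_tail_0 (a : nat -> R) :
  ex_series a -> is_lim_seq (fun n => Series a - sum_n a n) 0.
Proof.
  intros H. apply Series_correct in H.
  replace (Finite 0) with (Finite (Series a - Series a)) by (f_equal; ring).
  apply is_lim_seq_minus'; [apply is_lim_seq_const|exact H].
Qed.

Lemma Cmod_sum_n_diff (u : nat -> C) (n k : nat) :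
  Cmod (sum_n u (n + k) - sum_n u n)%C
  <= sum_n (fun i => Cmod (u i)) (n + k) - sum_n (fun i => Cmod (u i)) n.
Proof.
  induction k as [|k IH].
  - rewrite Nat.add_0_r.
    replace (sum_n u n - sum_n u n)%C with (RtoC 0) by ring.
    rewrite Cmod_0. lra.
  - rewrite Nat.add_succ_r, !sum_Sn.
    change (Cmod (sum_n u (n + k) + u (S (n + k)) - sum_n u n)%C
      <= sum_n (fun i => Cmod (u i)) (n + k) + Cmod (u (S (n + k)))
         - sum_n (fun i => Cmod (u i)) n).
    replace (sum_n u (n + k) + u (S (n + k)) - sum_n u n)%C
      with ((sum_n u (n + k) - sum_n u n) + u (S (n + k)))%C by ring.
    eapply Rle_trans; [apply Cmod_triangle|lra].
Qed.

Lemma Cmod_series_tail (u : nat -> C) (l : C) (n : nat) :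
  is_Cseries u l ->
  ex_series (fun i => Cmod (u i)) ->
  Cmod (l - sum_n u n)%C
  <= Series (fun i => Cmod (u i)) - sum_n (fun i => Cmod (u i)) n.
Proof.
  intros Hl Hex. apply le_epsilon. intros eps Heps.
  destruct (proj1 (is_series_Cmod u l) Hl eps Heps) as [N HN].
  specialize (HN (n + N)%nat ltac:(lia)).
  pose proof (Cmod_sum_n_diff u n N) as H1.
  pose proof (sum_n_le_Series (fun i => Cmod (u i)) (n + N) (fun i => Cmod_ge_0 _) Hex) as H2.
  replace (l - sum_n u n)%C
    with (- (sum_n u (n + N)%nat - l) + (sum_n u (n + N)%nat - sum_n u n))%C by ring.
  eapply Rle_trans; [apply Cmod_triangle|]. rewrite Cmod_opp. lra.
Qed.

Lemma Cmod_series_le (u : nat -> C) (l : C) :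
  is_Cseries u l -> ex_series (fun i => Cmod (u i)) ->
  Cmod l <= Series (fun i => Cmod (u i)).
Proof.
  intros Hl Hex. pose proof (Cmod_series_tail u l 0 Hl Hex) as H.
  rewrite !sum_O in H.
  replace l with ((l - u 0%nat) + u 0%nat)%C by cring.
  eapply Rle_trans; [apply Cmod_triangle|]. lra.
Qed.

Lemma ex_series_Cmod_le (u : nat -> C) (b : nat -> R) :
  (forall n, Cmod (u n) <= b n) -> ex_series b -> ex_series (fun n => Cmod (u n)).
Proof.
  intros Hle. apply (@ex_series_le R_AbsRing R_CompleteNormedModule).
  intros n. change (Rabs (Cmod (u n)) <= b n).
  rewrite Rabs_pos_eq by apply Cmod_ge_0. apply Hle.
Qed.

Lemma ex_series_Cmod_plus (u v : nat -> C) :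
  ex_series (fun n => Cmod (u n)) -> ex_series (fun n => Cmod (v n)) ->
  ex_series (fun n => Cmod (u n + v n)%C).
Proof.
  intros Hu Hv.
  apply ex_series_Cmod_le with (b := fun n => Cmod (u n) + Cmod (v n)).
  - intros n. apply Cmod_triangle.
  - exact (@ex_series_plus R_AbsRing R_NormedModule _ _ Hu Hv).
Qed.

Lemma ex_series_Cmod_single (k : nat) (c : C) :
  ex_series (fun l => Cmod (if Nat.eqb l k then c else 0)).
Proof.
  exists (Cmod c). apply is_series_ext with (a := fun l => if Nat.eqb l k then Cmod c else 0).
  - intros l. destruct (Nat.eqb l k); [reflexivity|]. now rewrite Cmod_0.
  - apply (@is_series_single R_AbsRing R_NormedModule).
Qed.

Lemma ex_series_Cmod_sqr (u : nat -> C) :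
  ex_series (fun i => Cmod (u i)) -> ex_series (fun i => Cmod (u i) ^ 2).
Proof.
  intros Hex.
  apply (ex_series_ext (fun i => Cmod (u i * u i)%C)).
  { intros i. rewrite Cmod_mult. simpl. ring. }
  apply ex_series_Cmod_le with (b := fun i => Series (fun i => Cmod (u i)) * Cmod (u i)).
  - intros i. rewrite Cmod_mult. apply Rmult_le_compat_r; [apply Cmod_ge_0|].
    exact (term_le_Series _ i (fun i => Cmod_ge_0 (u i)) Hex).
  - exact (@ex_series_scal_l R_AbsRing R_NormedModule _ _ Hex).
Qed.

Lemma pow_n_Cpow (z : C) (n : nat) : @pow_n C_Ring z n = (z ^ n)%C.
Proof. induction n as [|n IH]; simpl; [reflexivity|]. now rewrite IH. Qed.

Lemma is_pseries_C (a : nat -> C) (z l : C) :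
  @is_pseries C_AbsRing C_NormedModule a z l <->
  is_Cseries (fun n => a n * z ^ n)%C l.
Proof.
  assert (H : forall n, scal (pow_n (z : C_AbsRing) n) (a n : C_NormedModule) = (a n * z ^ n)%C).
  { intros n. rewrite <- pow_n_Cpow. apply Cmult_comm. }
  split; apply is_series_ext; intros n; [|symmetry]; apply H.
Qed.

Lemma CV_radius_ge_1 (c : nat -> R) :
  (forall r, 0 <= r < 1 -> exists M, forall n, Rabs (c n * r ^ n) <= M) ->
  Rbar_le 1 (CV_radius c).
Proof.
  intros H. destruct (CV_radius_bounded c) as [Hub _].
  assert (Hr : forall r, 0 <= r < 1 -> Rbar_le r (CV_radius c)).
  { intros r Hr. apply Hub. apply H, Hr. }
  destruct (CV_radius c) as [x| |] eqn:E; simpl in *; auto.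
  - destruct (Rle_dec 1 x) as [|Hx]; [assumption|].
    assert (H0 := Hr 0 ltac:(lra)).
    specialize (Hr ((1 + x) / 2) ltac:(lra)). lra.
  - apply (Hr 0). lra.
Qed.

(** The partial sums at a point [r < 1] converge, so they are bounded and so are the
    terms [a_n r^n]. *)
Lemma CV_radius_power_series (F : C -> C) (a : nat -> C) :
  power_series_on_disk F a -> Rbar_le 1 (CV_radius (fun n => Cmod (a n))).
Proof.
  intros H. apply CV_radius_ge_1. intros r Hr.
  assert (Hz : unit_disk r) by (unfold unit_disk; rewrite Cmod_R, Rabs_pos_eq; lra).
  specialize (H (RtoC r) Hz). apply is_pseries_C in H.
  destruct (@filterlim_bounded C_AbsRing C_NormedModule _ (ex_intro _ (F r) H)) as [M HM].
  change (forall n, Cmod (sum_n (fun i => a i * r ^ i)%C n) <= M) in HM.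
  exists (M + M). intros n.
  rewrite Rabs_mult, <- RPow_abs, (Rabs_pos_eq (Cmod _)) by apply Cmod_ge_0.
  rewrite <- Cmod_R, <- Cmod_pow, <- Cmod_mult.
  pose proof (HM n) as H1. pose proof (Cmod_ge_0 (sum_n (fun i => a i * r ^ i)%C n)).
  destruct n as [|n].
  - rewrite sum_O in H1. rewrite sum_O in H0. lra.
  - rewrite sum_Sn in H1. change (plus ?x ?y) with (Cplus x y) in H1.
    specialize (HM n).
    set (s := sum_n (fun i => a i * r ^ i)%C n) in *.
    replace (a (S n) * r ^ S n)%C with ((s + a (S n) * r ^ S n) + - s)%C by cring.
    eapply Rle_trans; [apply Cmod_triangle|]. rewrite Cmod_opp. lra.
Qed.

Lemma ex_series_inside (c : nat -> R) (r : R) :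
  Rbar_le 1 (CV_radius c) -> 0 <= r < 1 -> ex_series (fun n => c n * r ^ n).
Proof.
  intros Hc Hr. apply ex_series_Rabs, CV_disk_inside.
  eapply Rbar_lt_le_trans; [|exact Hc]. simpl. rewrite Rabs_pos_eq; lra.
Qed.

(** * Parseval on the circle by roots of unity *)

Lemma exists_primitive_root (n : nat) :
  exists z : C, Cmod z = 1 /\ (z ^ S n)%C = RtoC 1 /\
    forall p, (1 <= p <= n)%nat -> (z ^ p)%C <> RtoC 1.
Proof.
  assert (Hpow : forall x k, ((cos x, sin x) ^ k)%C = (cos (INR k * x), sin (INR k * x))).
  { intros x k. induction k as [|k IH].
    - simpl. now rewrite Rmult_0_l, cos_0, sin_0.
    - rewrite Cpow_S, IH, S_INR.
      replace ((INR k + 1) * x) with (x + INR k * x) by ring.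
      rewrite cos_plus, sin_plus. unfold Cmult; simpl. f_equal; ring. }
  assert (Hn : 0 < INR (S n)) by (apply lt_0_INR; lia).
  pose proof PI_RGT_0 as HPI.
  exists (cos (2 * PI / INR (S n)), sin (2 * PI / INR (S n))).
  split; [|split].
  - generalize (2 * PI / INR (S n)). intros x. unfold Cmod; simpl.
    replace (_ + _) with 1; [apply sqrt_1|].
    pose proof (sin2_cos2 x) as E. unfold Rsqr in E. lra.
  - rewrite Hpow.
    replace (INR (S n) * (2 * PI / INR (S n))) with (2 * PI) by (field; lra).
    now rewrite cos_2PI, sin_2PI.
  - intros p Hp. rewrite Hpow. intros H.
    assert (Hc : cos (INR p * (2 * PI / INR (S n))) = 1) by (injection H; auto).
    set (y := INR p * (PI / INR (S n))).
    replace (INR p * (2 * PI / INR (S n))) with (2 * y) in Hc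
      by (unfold y; field; lra).
    rewrite cos_2a_sin in Hc.
    assert (0 < sin y); [|nra].
    assert (0 < INR p) by (apply lt_0_INR; lia).
    assert (INR p < INR (S n)) by (apply lt_INR; lia).
    assert (Hq : 0 < PI / INR (S n)) by (apply Rdiv_lt_0_compat; lra).
    apply sin_gt_0; unfold y; [nra|].
    apply Rlt_le_trans with (INR (S n) * (PI / INR (S n))); [nra|].
    right. field. lra.
Qed.

Lemma sum_n_geom_root (q : C) (n : nat) :
  (q ^ S n)%C = RtoC 1 -> q <> RtoC 1 -> sum_n (fun j => q ^ j)%C n = RtoC 0.
Proof.
  intros H1 Hq.
  assert (Hg : forall m, ((q - 1) * sum_n (fun j => q ^ j) m = q ^ S m - 1)%C).
  { induction m as [|m IH]; [rewrite sum_O, Cpow_1_r; change (q ^ 0)%C with (RtoC 1); ring|].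
    rewrite sum_Sn. change (plus ?x ?y) with (Cplus x y).
    rewrite Cmult_plus_distr_l, IH, !Cpow_S. ring. }
  specialize (Hg n). rewrite H1 in Hg.
  assert (Hq' : (q - 1)%C <> RtoC 0).
  { intros E. apply Hq. replace q with ((q - 1) + 1)%C by ring. rewrite E. ring. }
  replace (sum_n (fun j => q ^ j)%C n)
    with (/ (q - 1) * ((q - 1) * sum_n (fun j => q ^ j)%C n))%C by (field; exact Hq').
  rewrite Hg. replace (RtoC 1 - RtoC 1)%C with (RtoC 0) by ring. apply Cmult_0_r.
Qed.

Lemma Cmod2_plus (x y : C) :
  Cmod (x + y)%C ^ 2 = Cmod x ^ 2 + Cmod y ^ 2 + 2 * Re (x * Cconj y)%C.
Proof. rewrite !Cmod2_alt. destruct x, y; simpl. ring. Qed.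

Lemma sum_n_root_orthogonal (z : C) (n : nat) (u : nat -> C) (m k : nat) :
  Cmod z = 1 -> (z ^ S n)%C = RtoC 1 ->
  (forall p, (1 <= p <= n)%nat -> (z ^ p)%C <> RtoC 1) ->
  (m < k <= n)%nat ->
  sum_n (fun j => sum_n (fun i => u i * (z ^ j) ^ i) m * Cconj ((z ^ j) ^ k))%C n
  = RtoC 0.
Proof.
  intros Hz H1 Hp Hmk.
  erewrite sum_n_ext with (b := fun j =>
    sum_n (fun i => u i * (z ^ j) ^ i * Cconj ((z ^ j) ^ k))%C m).
  2:{ intros j. symmetry. apply (@sum_n_mult_r C_Ring). }
  rewrite sum_n_switch.
  rewrite (sum_n_ext_loc _ (fun i => RtoC 0 * RtoC 0)%C), sum_n_Cmult_l; [apply Cmult_0_l|].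
  intros i Hi. rewrite Cmult_0_l.
  erewrite sum_n_ext with (b := fun j => (u i * (Cconj (z ^ (k - i))) ^ j)%C).
  2:{ intros j. rewrite <- Cmult_assoc. f_equal.
      replace k with (i + (k - i))%nat at 1 by lia.
      rewrite Cpow_add_r, Cmult_conj, Cmult_assoc, <- Cmod2_conj.
      rewrite !Cmod_pow, Hz, !pow1, Cmult_1_l.
      rewrite <- Cpow_conj, <- !Cpow_mult_r. do 2 f_equal. lia. }
  assert (Hc1 : Cconj (RtoC 1) = RtoC 1) by (unfold Cconj, RtoC; simpl; f_equal; ring).
  rewrite sum_n_Cmult_l, sum_n_geom_root; [apply Cmult_0_r| |].
  - rewrite <- Cpow_conj, <- Cpow_mult_r, Nat.mul_comm, Cpow_mult_r, H1, Cpow_1_l.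
    exact Hc1.
  - intros E. apply (Hp (k - i)%nat ltac:(lia)).
    now rewrite <- (Cconj_conj (z ^ _)%C), E.
Qed.

(** Parseval for polynomials, by induction on the degree: the new monomial is orthogonal
    to all the previous ones on the roots of unity. *)
Lemma parseval_root (z : C) (n : nat) (u : nat -> C) (m : nat) :
  Cmod z = 1 -> (z ^ S n)%C = RtoC 1 ->
  (forall p, (1 <= p <= n)%nat -> (z ^ p)%C <> RtoC 1) ->
  (m <= n)%nat ->
  sum_n (fun j => Cmod (sum_n (fun i => u i * (z ^ j) ^ i)%C m) ^ 2) n
  = INR (S n) * sum_n (fun i => Cmod (u i) ^ 2) m.
Proof.
  intros Hz H1 Hp.
  assert (Hu : forall j i, Cmod (u i * (z ^ j) ^ i)%C = Cmod (u i)).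
  { intros j i. now rewrite Cmod_mult, !Cmod_pow, Hz, !pow1, Rmult_1_r. }
  induction m as [|m IH]; intros Hm.
  - erewrite sum_n_ext; [|intros j; rewrite sum_O, Hu; reflexivity].
    now rewrite sum_n_const, sum_O.
  - erewrite sum_n_ext.
    2:{ intros j. rewrite sum_Sn. change (plus ?x ?y) with (Cplus x y).
        rewrite Cmod2_plus, Hu, Rplus_assoc. reflexivity. }
    rewrite (@sum_n_plus R_AbelianMonoid), IH by lia.
    rewrite (@sum_n_plus R_AbelianMonoid), sum_n_const.
    rewrite (@sum_n_mult_l R_Ring), <- sum_n_Re.
    erewrite sum_n_ext with (b := fun j =>
      (Cconj (u (S m)) *
       (sum_n (fun i => u i * (z ^ j) ^ i) m * Cconj ((z ^ j) ^ S m)))%C).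
    2:{ intros j. rewrite Cmult_conj. cring. }
    rewrite sum_n_Cmult_l, sum_n_root_orthogonal by (assumption || lia).
    rewrite sum_Sn, Cmult_0_r.
    unfold plus, mult; simpl. ring.
Qed.

(** On the circle both [U] and its partial sum [U_n] are bounded by the sum of the
    coefficients, and they differ by at most the tail; so [|U|^2 - |U_n|^2], which is
    [(|U| - |U_n|) (|U| + |U_n|)] in absolute value, is controlled uniformly, and so is its mean. *)
Lemma mean_square_tail (z : C) (n : nat) (u : nat -> C) (U : C -> C) :
  Cmod z = 1 -> (z ^ S n)%C = RtoC 1 ->
  (forall p, (1 <= p <= n)%nat -> (z ^ p)%C <> RtoC 1) ->
  ex_series (fun i => Cmod (u i)) ->
  (forall x, Cmod x = 1 -> is_Cseries (fun i => u i * x ^ i)%C (U x)) ->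
  Rabs (/ INR (S n) * sum_n (fun j => Cmod (U (z ^ j)%C) ^ 2) n
        - sum_n (fun i => Cmod (u i) ^ 2) n)
  <= 2 * Series (fun i => Cmod (u i)) *
     (Series (fun i => Cmod (u i)) - sum_n (fun i => Cmod (u i)) n).
Proof.
  intros Hz H1 Hp Hex HU.
  set (S0 := Series (fun i => Cmod (u i))).
  set (tau := S0 - sum_n (fun i => Cmod (u i)) n).
  assert (Hn : 0 < INR (S n)) by (apply lt_0_INR; lia).
  assert (Hj : forall j, Cmod (z ^ j)%C = 1) by (intros j; now rewrite Cmod_pow, Hz, pow1).
  assert (Hu : forall j i, Cmod (u i * (z ^ j) ^ i)%C = Cmod (u i)).
  { intros j i. now rewrite Cmod_mult, Cmod_pow, Hj, pow1, Rmult_1_r. }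
  assert (Hterm : forall j,
    Rabs (Cmod (U (z ^ j)%C) ^ 2 - Cmod (sum_n (fun i => u i * (z ^ j) ^ i)%C n) ^ 2)
    <= 2 * S0 * tau).
  { intros j. set (A := U (z ^ j)%C). set (B := sum_n (fun i => u i * (z ^ j) ^ i)%C n).
    assert (Hex' : ex_series (fun i => Cmod (u i * (z ^ j) ^ i)%C)).
    { eapply ex_series_ext; [|exact Hex]. intros i. now rewrite Hu. }
    pose proof (fun k => Cmod_series_tail _ _ k (HU _ (Hj j)) Hex') as Ht. cbv beta in Ht.
    assert (ES : Series (fun i => Cmod (u i * (z ^ j) ^ i)%C) = S0)
      by (apply Series_ext; intros i; apply Hu).
    assert (Es : forall k, sum_n (fun i => Cmod (u i * (z ^ j) ^ i)%C) k
                 = sum_n (fun i => Cmod (u i)) k) by (intros k; apply sum_n_ext; intros i; apply Hu).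
    assert (HAB : Cmod (A - B)%C <= tau) by (specialize (Ht n); rewrite ES, Es in Ht; exact Ht).
    assert (HA : Cmod A <= S0).
    { rewrite <- ES. now apply Cmod_series_le; [apply HU|]. }
    assert (HB : Cmod B <= S0).
    { pose proof (Cmod_sum_n_diff (fun i => u i * (z ^ j) ^ i)%C 0 n) as Hd. cbv beta in Hd.
      rewrite Nat.add_0_l, !Es, !sum_O in Hd. cbv beta in Hd. fold B in Hd.
      rewrite <- (Hu j 0%nat) in Hd.
      pose proof (sum_n_le_Series _ n (fun i => Cmod_ge_0 (u i)) Hex) as Hs. fold S0 in Hs.
      replace B with ((B - u 0%nat * (z ^ j) ^ 0) + u 0%nat * (z ^ j) ^ 0)%C by cring.
      eapply Rle_trans; [apply Cmod_triangle|]. lra. }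
    assert (Rabs (Cmod A - Cmod B) <= tau).
    { apply Rabs_le.
      assert (Cmod A <= Cmod (A - B)%C + Cmod B)
        by (replace A with ((A - B) + B)%C at 1 by cring; apply Cmod_triangle).
      assert (Cmod B <= Cmod (A - B)%C + Cmod A)
        by (rewrite <- (Cmod_opp (A - B)%C); replace B with (- (A - B) + A)%C at 1 by cring; apply Cmod_triangle).
      lra. }
    replace (Cmod A ^ 2 - Cmod B ^ 2) with ((Cmod A - Cmod B) * (Cmod A + Cmod B)) by ring.
    pose proof (Cmod_ge_0 A). pose proof (Cmod_ge_0 B).
    rewrite Rabs_mult, (Rabs_pos_eq (Cmod A + Cmod B)) by lra.
    pose proof (Rabs_pos (Cmod A - Cmod B)). nra. }
  pose proof (parseval_root z n u n Hz H1 Hp (le_n n)) as HP.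
  replace (sum_n (fun i => Cmod (u i) ^ 2) n) with
    (/ INR (S n) * sum_n (fun j => Cmod (sum_n (fun i => u i * (z ^ j) ^ i)%C n) ^ 2) n)
    by (rewrite HP; field; lra).
  rewrite <- Rmult_minus_distr_l.
  assert (Hsum : forall m, Rabs (sum_n (fun j => Cmod (U (z ^ j)%C) ^ 2) m
     - sum_n (fun j => Cmod (sum_n (fun i => u i * (z ^ j) ^ i)%C n) ^ 2) m)
     <= INR (S m) * (2 * S0 * tau)).
  { induction m as [|m IH].
    - rewrite !sum_O. simpl (INR 1). rewrite Rmult_1_l. apply Hterm.
    - rewrite !sum_Sn, (S_INR (S m)). unfold plus; simpl plus.
      specialize (Hterm (S m)). revert Hterm IH. unfold Rabs.
      repeat destruct Rcase_abs; intros; simpl in *; lra. }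
  rewrite Rabs_mult, Rabs_pos_eq by (left; apply Rinv_0_lt_compat; lra).
  apply (Rmult_le_reg_l (INR (S n))); [lra|].
  rewrite <- Rmult_assoc, Rinv_r, Rmult_1_l by lra. apply Hsum.
Qed.

(** Means over the [n + 1]-st roots of unity preserve the pointwise inequality and tend
    to the two series as [n] grows. *)
Lemma l2_norm_monotone (u v : nat -> C) (U V : C -> C) :
  ex_series (fun i => Cmod (u i)) -> ex_series (fun i => Cmod (v i)) ->
  (forall x, Cmod x = 1 -> is_Cseries (fun i => u i * x ^ i)%C (U x)) ->
  (forall x, Cmod x = 1 -> is_Cseries (fun i => v i * x ^ i)%C (V x)) ->
  (forall x, Cmod x = 1 -> Cmod (U x) <= Cmod (V x)) ->
  Series (fun i => Cmod (u i) ^ 2) <= Series (fun i => Cmod (v i) ^ 2).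
Proof.
  intros Hu Hv HU HV Hle.
  set (Su := Series (fun i => Cmod (u i))). set (Sv := Series (fun i => Cmod (v i))).
  set (tu := fun n => Su - sum_n (fun i => Cmod (u i)) n).
  set (tv := fun n => Sv - sum_n (fun i => Cmod (v i)) n).
  assert (Hn : forall n, sum_n (fun i => Cmod (u i) ^ 2) n <=
    sum_n (fun i => Cmod (v i) ^ 2) n + (2 * Su * tu n + 2 * Sv * tv n)).
  { intros n. destruct (exists_primitive_root n) as (z & Hz & H1 & Hp).
    pose proof (mean_square_tail z n u U Hz H1 Hp Hu HU) as Mu.
    pose proof (mean_square_tail z n v V Hz H1 Hp Hv HV) as Mv.
    fold Su in Mu. fold (tu n) in Mu. fold Sv in Mv. fold (tv n) in Mv.
    apply Rabs_le_between in Mu. apply Rabs_le_between in Mv.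
    assert (/ INR (S n) * sum_n (fun j => Cmod (U (z ^ j)%C) ^ 2) n <=
            / INR (S n) * sum_n (fun j => Cmod (V (z ^ j)%C) ^ 2) n).
    { apply Rmult_le_compat_l.
      - left. apply Rinv_0_lt_compat, lt_0_INR. lia.
      - apply sum_n_Rle. intros j. apply pow_incr. split; [apply Cmod_ge_0|].
        apply Hle. now rewrite Cmod_pow, Hz, pow1. }
    lra. }
  set (su := Series (fun i => Cmod (u i) ^ 2)). set (sv := Series (fun i => Cmod (v i) ^ 2)).
  change (Rbar_le su sv).
  apply (is_lim_seq_le (sum_n (fun i => Cmod (u i) ^ 2))
    (fun n => sum_n (fun i => Cmod (v i) ^ 2) n + (2 * Su * tu n + 2 * Sv * tv n))); auto.
  - apply Series_correct, ex_series_Cmod_sqr, Hu.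
  - replace sv with (sv + (2 * Su * 0 + 2 * Sv * 0)) by ring.
    apply is_lim_seq_plus'; [apply Series_correct, ex_series_Cmod_sqr, Hv|].
    apply is_lim_seq_plus'.
    + apply (is_lim_seq_scal_l tu (2 * Su) 0), is_series_tail_0, Hu.
    + apply (is_lim_seq_scal_l tv (2 * Sv) 0), is_series_tail_0, Hv.
Qed.

(** * Coefficients of a function with bounded real part *)

Lemma bernoulli_le (r : R) (n : nat) : 0 <= r <= 1 -> 1 - INR n * (1 - r) <= r ^ n.
Proof.
  intros Hr. induction n as [|n IH]; [simpl; lra|].
  rewrite S_INR, <- tech_pow_Rmult. pose proof (pos_INR n) as Hn.
  assert (r * (1 - INR n * (1 - r)) <= r * r ^ n) by (apply Rmult_le_compat_l; lra).
  assert (0 <= INR n * ((1 - r) * (1 - r))) by (apply Rmult_le_pos; nra). nra.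
Qed.

Lemma le_of_forall_pow (c X : R) (n : nat) :
  0 <= c -> (forall r, 0 < r < 1 -> c * r ^ n <= X) -> c <= X.
Proof.
  intros Hc H. apply le_epsilon. intros eps Heps.
  pose proof (pos_INR n) as Hn.
  assert (Hd : 0 < c * INR n + 1) by nra.
  set (s := Rmin (1 / 2) (eps / (c * INR n + 1))).
  assert (Hs : 0 < s) by (apply Rmin_pos; [lra|now apply Rdiv_lt_0_compat]).
  assert (Hs1 : s <= 1 / 2) by apply Rmin_l.
  assert (Hs2 : s * (c * INR n + 1) <= eps).
  { apply Rle_trans with (eps / (c * INR n + 1) * (c * INR n + 1)).
    - apply Rmult_le_compat_r; [lra|apply Rmin_r].
    - right. field. lra. }
  specialize (H (1 - s) ltac:(lra)).
  pose proof (bernoulli_le (1 - s) n ltac:(lra)). nra.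
Qed.

Lemma exists_unimodular_aligned (w : C) :
  exists e : C, Cmod e = 1 /\ Re (w * Cconj e)%C = Cmod w.
Proof.
  destruct (Req_dec (Cmod w) 0) as [E|E].
  - exists (RtoC 1). rewrite Cmod_1, E. split; [reflexivity|].
    apply Cmod_eq_0 in E. subst w. simpl. ring.
  - assert (Hw : w <> RtoC 0) by (intros F; apply E; rewrite F; apply Cmod_0).
    assert (HR : RtoC (Cmod w) <> RtoC 0) by (intros F; injection F; auto).
    exists (w / Cmod w)%C.
    assert (Hpos := Cmod_ge_0 w).
    split.
    + rewrite Cmod_div, Cmod_R, Rabs_pos_eq by assumption. field. assumption.
    + replace (Cconj (w / Cmod w)) with (Cconj w / Cmod w)%C.
      2:{ rewrite Cdiv_conj by assumption. f_equal.
          unfold Cconj, RtoC; simpl. f_equal. ring. }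
      replace (w * (Cconj w / Cmod w))%C with ((w * Cconj w) / Cmod w)%C by (field; assumption).
      rewrite <- Cmod2_conj, <- RtoC_div by assumption. simpl. field. assumption.
Qed.

(** Put [P(x) = B - F(r x)], whose real part is nonnegative, and [Q(x) = 1 + e x^n] with
    [|e| = 1].  Then [|P - 1| <= |P + 1|], hence [|P Q - Q| <= |P Q + Q|] on the circle, and
    comparing the two [l2] norms leaves four times the real part of the inner product of
    [P Q] and [Q], which is therefore nonnegative.  Only the coefficients of index [0] and
    [n] of [Q] are nonzero, so this is an inequality between [p_0] and [p_n]; choosing [e]
    aligned with [a_n] and letting [r] tend to [1] gives the bound. *)
Lemma real_part_coefficient_bound (F : C -> C) (a : nat -> C) (B : R) (n : nat) :
  power_series_on_disk F a -> (forall z, unit_disk z -> Re (F z) <= B) ->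
  (1 <= n)%nat -> Cmod (a n) <= 2 * (B - Re (a 0%nat)).
Proof.
  intros HF HB Hn.
  apply (le_of_forall_pow _ _ n (Cmod_ge_0 _)). intros r Hr.
  destruct (exists_unimodular_aligned (a n)) as (e & He & Hae).
  pose (p := fun l => ((if Nat.eqb l 0 then RtoC B else RtoC 0) - a l * r ^ l)%C).
  pose (q := fun l => ((if Nat.eqb l 0 then RtoC 1 else RtoC 0) + (if Nat.eqb l n then e else RtoC 0))%C).
  pose (s := fun l => (p l + e * @PS_incr_n C_AbsRing C_NormedModule p n l)%C).
  (* [p], [q] and [s] are the coefficients of [P], [Q] and [P Q]. *)
  assert (Hp : ex_series (fun l => Cmod (p l))).
  { apply ex_series_Cmod_plus; [apply ex_series_Cmod_single|].
    apply ex_series_Cmod_le with (b := fun l => Cmod (a l) * r ^ l).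
    - intros l. rewrite Cmod_opp, Cmod_mult, Cmod_pow, Cmod_R, Rabs_pos_eq; lra.
    - apply (ex_series_inside (fun l => Cmod (a l))); [|lra].
      now apply CV_radius_power_series with F. }
  assert (Hs : ex_series (fun l => Cmod (s l))).
  { apply ex_series_Cmod_plus; [exact Hp|].
    apply ex_series_Cmod_le with
      (b := fun l => Cmod (@PS_incr_n C_AbsRing C_NormedModule p n l)).
    - intros l. rewrite Cmod_mult, He. lra.
    - apply (ex_series_incr_n _ n). eapply ex_series_ext; [|exact Hp].
      intros l. rewrite PS_incr_n_simplify.
      destruct (Compare_dec.le_lt_dec n (n + l)); [|lia]. do 2 f_equal. lia. }
  assert (Hq : ex_series (fun l => Cmod (q l)))
    by (apply ex_series_Cmod_plus; apply ex_series_Cmod_single).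
  assert (Hq' : ex_series (fun l => Cmod (- q l)%C))
    by (eapply ex_series_ext; [|exact Hq]; intros l; now rewrite Cmod_opp).
  assert (Hdisk : forall x, Cmod x = 1 -> unit_disk (r * x)).
  { intros x Hx. unfold unit_disk. rewrite Cmod_mult, Hx, Cmod_R, Rabs_pos_eq; lra. }
  pose (P := fun x => (B - F (r * x))%C).
  pose (Q := fun x => (1 + e * x ^ n)%C).
  assert (HsP : forall x, Cmod x = 1 -> is_Cseries (fun l => p l * x ^ l)%C (P x)).
  { intros x Hx.
    apply is_series_ext with (a := fun l =>
      ((if Nat.eqb l 0 then RtoC B else RtoC 0) - a l * (r * x) ^ l)%C).
    - intros l. unfold p. rewrite Cpow_mult_l.
      destruct l as [|l]; simpl Nat.eqb; cbv iota; [simpl Cpow|]; cring.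
    - apply is_Cseries_minus; [apply (@is_series_single C_AbsRing C_NormedModule)|].
      now apply is_pseries_C, HF, Hdisk. }
  assert (HsQ : forall x, is_Cseries (fun l => q l * x ^ l)%C (Q x)).
  { intros x.
    apply is_series_ext with (a := fun l =>
      ((if Nat.eqb l 0 then RtoC 1 else RtoC 0)
       + (if Nat.eqb l n then (e * x ^ n) else RtoC 0))%C).
    - intros l. unfold q. destruct (Nat.eqb_spec l 0) as [E0|]; destruct (Nat.eqb_spec l n) as [E1|];
        try lia; rewrite ?E0, ?E1; simpl Cpow; cring.
    - apply is_Cseries_plus; apply (@is_series_single C_AbsRing C_NormedModule). }
  assert (HsS : forall x, Cmod x = 1 -> is_Cseries (fun l => s l * x ^ l)%C (P x * Q x)%C).
  { intros x Hx.
    replace (P x * Q x)%C with (P x + e * (x ^ n * P x))%C by (unfold Q; cring).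
    apply is_series_ext with (a := fun l =>
      (p l * x ^ l + e * (@PS_incr_n C_AbsRing C_NormedModule p n l * x ^ l))%C).
    - intros l. unfold s. cring.
    - apply is_Cseries_plus; [now apply HsP|]. apply is_Cseries_mult_l.
      apply is_pseries_C. rewrite <- pow_n_Cpow.
      apply (@is_pseries_incr_n C_AbsRing C_NormedModule), is_pseries_C, HsP, Hx. }
  assert (Hle : Series (fun l => Cmod (s l - q l)%C ^ 2) <= Series (fun l => Cmod (s l + q l)%C ^ 2)).
  { apply (l2_norm_monotone _ _ (fun x => P x * Q x - Q x)%C (fun x => P x * Q x + Q x)%C).
    - now apply ex_series_Cmod_plus.
    - now apply ex_series_Cmod_plus.
    - intros x Hx. apply is_series_ext with (a := fun l => (s l * x ^ l - q l * x ^ l)%C).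
      + intros l. cring.
      + apply is_Cseries_minus; [now apply HsS|apply HsQ].
    - intros x Hx. apply is_series_ext with (a := fun l => (s l * x ^ l + q l * x ^ l)%C).
      + intros l. cring.
      + apply is_Cseries_plus; [now apply HsS|apply HsQ].
    - intros x Hx.
      replace (P x * Q x - Q x)%C with ((P x + - (1)) * Q x)%C by cring.
      replace (P x * Q x + Q x)%C with ((P x + 1) * Q x)%C by cring.
      rewrite !Cmod_mult. apply Rmult_le_compat_r; [apply Cmod_ge_0|].
      assert (HP : 0 <= Re (P x)).
      { pose proof (HB _ (Hdisk x Hx)).
        change (0 <= B + - Re (F (r * x)%C)). lra. }
      apply Rsqr_incr_0_var; [|apply Cmod_ge_0].
      rewrite !Rsqr_pow2, !Cmod2_plus, Cmod_opp.
      destruct (P x) as [px py]. simpl in *. nra. }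
  assert (Hdiff : Series (fun l => Cmod (s l + q l)%C ^ 2) - Series (fun l => Cmod (s l - q l)%C ^ 2)
    = 4 * Re (s 0%nat) + 4 * Re (s n * Cconj e)%C).
  { rewrite <- Series_minus.
    2,3: now apply ex_series_Cmod_sqr, ex_series_Cmod_plus.
    apply is_series_unique.
    apply is_series_ext with (a := fun l => (if Nat.eqb l 0 then 4 * Re (s 0%nat) else 0)
      + (if Nat.eqb l n then 4 * Re (s n * Cconj e)%C else 0)).
    - intros l. unfold Cminus. rewrite !Cmod2_plus, Cmod_opp. unfold q.
      destruct (Nat.eqb_spec l 0) as [E0|]; destruct (Nat.eqb_spec l n) as [E1|];
        try lia; rewrite ?E0, ?E1.
      + destruct (s 0%nat); simpl; ring.
      + destruct (s n), e; simpl; ring.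
      + destruct (s l); simpl; ring.
    - apply (@is_series_plus R_AbsRing R_NormedModule); apply (@is_series_single R_AbsRing R_NormedModule). }
  assert (Es0 : s 0%nat = p 0%nat).
  { unfold s. rewrite PS_incr_n_simplify. destruct (Compare_dec.le_lt_dec n 0); [lia|].
    change (p 0%nat + e * 0 = p 0%nat)%C. cring. }
  assert (Esn : s n = (p n + e * p 0%nat)%C).
  { unfold s. rewrite PS_incr_n_simplify. destruct (Compare_dec.le_lt_dec n n); [|lia].
    now rewrite Nat.sub_diag. }
  assert (Ep0 : Re (p 0%nat) = B - Re (a 0%nat)) by (unfold p; destruct (a 0%nat); simpl; ring).
  assert (Epn : Re (p n * Cconj e)%C = - (Cmod (a n) * r ^ n)).
  { unfold p. destruct (Nat.eqb_spec n 0); [lia|]. rewrite <- Hae, <- RtoC_pow.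
    destruct (a n), e. simpl Re. ring. }
  assert (Een : Re (s n * Cconj e)%C = Re (p n * Cconj e)%C + Re (p 0%nat)).
  { rewrite Esn. assert (E2 := Cmod2_alt e). rewrite He in E2.
    destruct (p n) as [x1 y1], (p 0%nat) as [x2 y2], e as [x3 y3]. simpl in *.
    assert (E3 : x2 * (x3 * x3 + y3 * y3) = x2) by (replace (x3 * x3 + y3 * y3) with 1 by lra; ring).
    lra. }
  rewrite Es0, Een, Ep0, Epn in Hdiff. lra.
Qed.

(** * Coefficients of a function subordinate to a convex function *)

(** In the frame where [q] is the origin and [p0] lies on the positive real axis, write
    [X] and [Y] for the coordinates.  The set meets the real axis only in positive points,
    since a segment from [p0] to a nonpositive one would contain [q].  Hence a segment
    between a point above the axis and a point below it crosses the axis on the positive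
    side, which says that [X / Y] is larger above than below.  The line [X = m Y], with
    [m] the supremum of the slopes [X / Y] below the axis, then separates; if one of the
    half-planes is missed, the real axis itself does. *)
Lemma convex_separation (S : C -> Prop) (q p0 : C) :
  convex_set S -> S p0 -> ~ S q ->
  exists c : C, c <> RtoC 0 /\ forall p, S p -> Re (c * (p - q))%C <= 0.
Proof.
  intros Hconv Hp0 Hq.
  set (v := (p0 - q)%C).
  set (X := fun p : C => Re (Cconj v * (p - q))%C).
  set (Y := fun p : C => Im (Cconj v * (p - q))%C).
  assert (Hv : v <> RtoC 0).
  { intros E. apply Hq. replace q with p0; [assumption|].
    replace p0 with (v + q)%C by (unfold v; ring). rewrite E. ring. }
  assert (Hv2 : 0 < Re v ^ 2 + Im v ^ 2).
  { rewrite <- Cmod2_alt. apply pow_lt. now apply Cmod_gt_0. }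
  assert (HX0 : 0 < X p0).
  { unfold X. fold v. destruct v as [v1 v2]. simpl in *. lra. }
  assert (HY0 : Y p0 = 0).
  { unfold Y. fold v. destruct v as [v1 v2]. simpl. ring. }
  assert (Hcomb : forall p p' s, S p -> S p' -> 0 <= s <= 1 ->
    exists p'', S p'' /\ X p'' = (1 - s) * X p + s * X p' /\ Y p'' = (1 - s) * Y p + s * Y p').
  { intros p p' s Hp Hp' Hs. eexists. split; [exact (Hconv p p' s Hp Hp' Hs)|].
    unfold X, Y. destruct v, p, p', q. simpl. split; ring. }
  assert (Hreal : forall p, S p -> Y p = 0 -> 0 < X p).
  { intros p Hp HY. destruct (Rlt_le_dec 0 (X p)) as [|HX]; [assumption|exfalso].
    (* the parameter at which the segment from [p0] to [p] meets the origin *)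
    set (s := X p0 / (X p0 - X p)).
    assert (Hs : 0 <= s <= 1).
    { unfold s. split.
      - apply Rdiv_le_0_compat; lra.
      - apply (Rmult_le_reg_r (X p0 - X p)); [lra|]. unfold Rdiv.
        rewrite Rmult_assoc, Rinv_l, Rmult_1_l, Rmult_1_r; lra. }
    destruct (Hcomb p0 p s Hp0 Hp Hs) as (r & Hr & HXr & HYr).
    rewrite HY, HY0 in HYr.
    assert (HXr0 : X r = 0) by (rewrite HXr; unfold s; field; lra).
    apply Hq. replace q with r; [assumption|].
    assert (E : (Cconj v * (r - q))%C = RtoC 0).
    { rewrite (surjective_pairing (Cconj v * (r - q))%C). unfold RtoC. f_equal.
      - exact HXr0.
      - change (Y r = 0). rewrite HYr. ring. }
    replace r with (/ Cconj v * (Cconj v * (r - q)) + q)%C.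
    - rewrite E. ring.
    - field. intros E'. apply Hv. rewrite <- (Cconj_conj v), E'.
      unfold Cconj, RtoC. simpl. f_equal. ring. }
  assert (Hcross : forall p p', S p -> S p' -> 0 < Y p -> Y p' < 0 -> X p' / Y p' < X p / Y p).
  { intros p p' Hp Hp' HY HY'.
    (* the parameter at which the segment from [p] to [p'] crosses the real axis *)
    set (s := Y p / (Y p - Y p')).
    assert (Hs : 0 <= s <= 1).
    { unfold s. split.
      - apply Rdiv_le_0_compat; lra.
      - apply (Rmult_le_reg_r (Y p - Y p')); [lra|]. unfold Rdiv.
        rewrite Rmult_assoc, Rinv_l, Rmult_1_l, Rmult_1_r; lra. }
    destruct (Hcomb p p' s Hp Hp' Hs) as (r & Hr & HXr & HYr).
    assert (HYr0 : Y r = 0) by (rewrite HYr; unfold s; field; lra).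
    pose proof (Hreal r Hr HYr0) as Hpos. rewrite HXr in Hpos.
    assert (E : (1 - s) * X p + s * X p' = (Y p * - Y p') / (Y p - Y p') * (X p / Y p - X p' / Y p'))
      by (unfold s; field; lra).
    rewrite E in Hpos.
    assert (0 < (Y p * - Y p') / (Y p - Y p')) by (apply Rdiv_lt_0_compat; nra).
    nra. }
  (* A functional of the rotated coordinates that is nonnegative on the set translates
     back into a multiplier [c]. *)
  assert (Hfin : forall al be : R, (al <> 0 \/ be <> 0) ->
    (forall p, S p -> 0 <= al * X p + be * Y p) ->
    exists c : C, c <> RtoC 0 /\ forall p, S p -> Re (c * (p - q))%C <= 0).
  { intros al be Hne H. exists (((- al)%R, be) * Cconj v)%C. split.
    - apply Cmult_neq_0.
      + intros E. injection E. intros. lra.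
      + intros E'. apply Hv. rewrite <- (Cconj_conj v), E'.
        unfold Cconj, RtoC. simpl. f_equal. ring.
    - intros p Hp. specialize (H p Hp). rewrite <- Cmult_assoc.
      unfold X, Y in H. destruct (Cconj v * (p - q))%C as [x y]. simpl in *. lra. }
  destruct (Classical_Prop.classic (exists p', S p' /\ Y p' < 0)) as [[p1 [Hp1 HY1]]|Hneg].
  2:{ apply (Hfin 0 1); [right; lra|]. intros p Hp.
      destruct (Rlt_le_dec (Y p) 0); [|lra]. exfalso. apply Hneg. now exists p. }
  destruct (Classical_Prop.classic (exists p, S p /\ 0 < Y p)) as [[p2 [Hp2 HY2]]|Hpos].
  2:{ apply (Hfin 0 (-1)); [right; lra|]. intros p Hp.
      destruct (Rlt_le_dec 0 (Y p)); [|lra]. exfalso. apply Hpos. now exists p. }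
  destruct (completeness (fun x => exists p', S p' /\ Y p' < 0 /\ x = X p' / Y p')) as [m [Hub Hlub]].
  - exists (X p2 / Y p2). intros x (p' & Hp' & HY' & ->). left. now apply Hcross.
  - now exists (X p1 / Y p1), p1.
  - apply (Hfin 1 (- m)); [left; lra|]. intros p Hp.
    destruct (Rtotal_order (Y p) 0) as [HY|[HY|HY]].
    + assert (X p / Y p <= m) by (apply Hub; now exists p).
      assert (X p = X p / Y p * Y p) by (field; lra). nra.
    + rewrite HY. pose proof (Hreal p Hp HY). lra.
    + assert (m <= X p / Y p).
      { apply Hlub. intros x (p' & Hp' & HY' & ->). left. now apply Hcross. }
      assert (X p = X p / Y p * Y p) by (field; lra). nra.
Qed.

Lemma power_series_at_0 (F : C -> C) (a : nat -> C) :
  power_series_on_disk F a -> F (RtoC 0) = a 0%nat.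
Proof.
  intros H. assert (H0 : unit_disk 0) by (unfold unit_disk; rewrite Cmod_0; lra).
  exact (filterlim_locally_unique _ _ _ (H _ H0)
    (@is_pseries_0 C_AbsRing C_NormedModule a)).
Qed.

Lemma subordinate_center (h phi : C -> C) :
  subordinate h phi -> h (RtoC 0) = phi (RtoC 0).
Proof.
  intros (w & _ & _ & Hw0 & Hh). rewrite Hh, Hw0; [reflexivity|].
  unfold unit_disk. rewrite Cmod_0. lra.
Qed.

(** Arbitrarily close to the boundary point [q] there is a point [q'] outside the image.
    Separating [q'] from the image bounds the real part of [c h] on the disk, and [q'] may
    then be moved to [q]. *)
Lemma convex_subordination_coefficient_bound (h phi : C -> C) (a : nat -> C) (q : C) (n : nat) :
  power_series_on_disk h a -> convex_set (disk_image phi) -> subordinate h phi ->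
  boundary (disk_image phi) q -> (1 <= n)%nat ->
  Cmod (a n) <= 2 * Cmod (phi (RtoC 0) - q)%C.
Proof.
  intros Hh Hconv Hsub Hq Hn.
  pose proof (subordinate_center h phi Hsub) as Hcenter.
  rewrite (power_series_at_0 h a Hh) in Hcenter.
  apply le_epsilon. intros eps Heps.
  destruct (proj2 (Hq (eps / 2) ltac:(lra))) as (q' & Hq' & Hqq').
  assert (H0 : disk_image phi (phi (RtoC 0))).
  { exists (RtoC 0). split; [|reflexivity]. unfold unit_disk. rewrite Cmod_0. lra. }
  destruct (convex_separation _ q' _ Hconv H0 Hq') as (c & Hc & Hsep).
  apply Cmod_gt_0 in Hc.
  assert (Hb : Cmod (c * a n)%C <= 2 * (Re (c * q')%C - Re (c * a 0%nat)%C)).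
  { apply (real_part_coefficient_bound (fun z => c * h z)%C (fun k => c * a k)%C); [| |exact Hn].
    - intros z Hz. apply is_pseries_C.
      apply is_series_ext with (a := fun k => (c * (a k * z ^ k))%C); [intros k; cring|].
      apply is_Cseries_mult_l, is_pseries_C, Hh, Hz.
    - intros z Hz. destruct Hsub as (w & _ & Hw & _ & Hhw).
      assert (Hp : disk_image phi (h z)) by (exists (w z); auto).
      specialize (Hsep _ Hp). destruct c, (h z), q'. simpl in *. lra. }
  rewrite Cmod_mult in Hb.
  assert (Hre : Re (c * q')%C - Re (c * a 0%nat)%C <= Cmod c * Cmod (a 0%nat - q')%C).
  { rewrite <- Cmod_mult. eapply Rle_trans; [|apply re_le_Cmod].
    replace (Re (c * q')%C - Re (c * a 0%nat)%C) with (- Re (c * (a 0%nat - q'))%C)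
      by (destruct c, (a 0%nat), q'; simpl; ring).
    rewrite <- Rabs_Ropp. apply Rle_abs. }
  rewrite Hcenter in *.
  assert (Htri : Cmod (phi (RtoC 0) - q')%C <= Cmod (phi (RtoC 0) - q)%C + Cmod (q' - q)%C).
  { rewrite <- (Cmod_opp (q' - q)%C).
    replace (phi (RtoC 0) - q')%C with ((phi (RtoC 0) - q) + - (q' - q))%C at 1 by ring.
    apply Cmod_triangle. }
  apply Rle_trans with (2 * Cmod (phi (RtoC 0) - q')%C); [|lra].
  apply (Rmult_le_reg_l (Cmod c)); [assumption|]. lra.
Qed.

(** * Termwise differentiation *)

(** A quadratic remainder is how differentiability is checked below, both for power series
    and for the extremal functions. *)
Lemma is_C_derive_of_quadratic (f : C -> C) (z l : C) (d M : R) :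
  0 < d ->
  (forall y, Cmod (y - z)%C < d -> Cmod (f y - f z - (y - z) * l)%C <= M * Cmod (y - z)%C ^ 2) ->
  @is_derive C_AbsRing C_NormedModule f z l.
Proof.
  intros Hd H. split.
  { apply is_linear_scal_l. }
  intros x Hx eps.
  apply (@is_filter_lim_locally_unique C_AbsRing (AbsRing_NormedModule C_AbsRing)) in Hx.
  subst x.
  pose proof (Rabs_pos M) as HM. pose proof (cond_pos eps) as He.
  assert (Hd' : 0 < Rmin d (eps / (Rabs M + 1))).
  { apply Rmin_pos; [assumption|]. apply Rdiv_lt_0_compat; lra. }
  exists (mkposreal _ Hd'). intros y Hy.
  change (Cmod (y - z)%C < Rmin d (eps / (Rabs M + 1))) in Hy.
  change (Cmod (f y - f z - (y - z) * l)%C <= eps * Cmod (y - z)%C).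
  assert (H1 : Cmod (y - z)%C < d) by (eapply Rlt_le_trans; [exact Hy|apply Rmin_l]).
  assert (H2 : Cmod (y - z)%C < eps / (Rabs M + 1)) by (eapply Rlt_le_trans; [exact Hy|apply Rmin_r]).
  eapply Rle_trans; [apply H, H1|].
  pose proof (Cmod_ge_0 (y - z)%C) as H0.
  assert (H3 : Cmod (y - z)%C * (Rabs M + 1) <= eps).
  { apply Rle_trans with (eps / (Rabs M + 1) * (Rabs M + 1)).
    - apply Rmult_le_compat_r; lra.
    - right. field. lra. }
  pose proof (Rle_abs M) as H4.
  replace (M * Cmod (y - z)%C ^ 2) with (M * Cmod (y - z)%C * Cmod (y - z)%C) by ring.
  apply Rmult_le_compat_r; [assumption|]. nra.
Qed.

(** The remainders [T_n] of the first order expansion of [y^(n+1)] satisfy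
    [T_(n+1) = y T_n + (n + 1) z^n (y - z)^2].  The factor [r] on the left stands for a
    power [r^(n-1)] on the right, which would be misread at [n = 0]. *)
Lemma Cmod_pow_taylor_le (y z : C) (r : R) (n : nat) :
  Cmod y <= r -> Cmod z <= r ->
  r * Cmod (y ^ S n - z ^ S n - (y - z) * (INR (S n) * z ^ n))%C
  <= INR n ^ 2 * r ^ n * Cmod (y - z)%C ^ 2.
Proof.
  intros Hy Hz. pose proof (Cmod_ge_0 y) as Hy0. pose proof (Cmod_ge_0 z) as Hz0.
  assert (Hr : 0 <= r) by lra.
  induction n as [|n IH].
  - replace (y ^ 1 - z ^ 1 - (y - z) * (INR 1 * z ^ 0))%C with (RtoC 0) by (simpl; cring).
    rewrite Cmod_0. simpl. lra.
  - assert (E : (y ^ S (S n) - z ^ S (S n) - (y - z) * (INR (S (S n)) * z ^ S n) =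
      y * (y ^ S n - z ^ S n - (y - z) * (INR (S n) * z ^ n))
      + INR (S n) * z ^ n * (y - z) ^ 2)%C).
    { rewrite (S_INR (S n)), RtoC_plus, !Cpow_S. simpl Cpow. ring. }
    rewrite E.
    set (T := Cmod (y ^ S n - z ^ S n - (y - z) * (INR (S n) * z ^ n))%C) in *.
    set (d := Cmod (y - z)%C) in *.
    assert (H1 : Cmod (y * (y ^ S n - z ^ S n - (y - z) * (INR (S n) * z ^ n))
      + INR (S n) * z ^ n * (y - z) ^ 2)%C <= r * T + INR (S n) * r ^ n * d ^ 2).
    { eapply Rle_trans; [apply Cmod_triangle|].
      rewrite !Cmod_mult, !Cmod_pow, Cmod_R, (Rabs_pos_eq (INR (S n))) by apply pos_INR.
      fold T d. apply Rplus_le_compat.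
      - apply Rmult_le_compat_r; [apply Cmod_ge_0|assumption].
      - apply Rmult_le_compat_r; [apply pow2_ge_0|].
        apply Rmult_le_compat_l; [apply pos_INR|]. now apply pow_incr. }
    apply Rle_trans with (r * (r * T + INR (S n) * r ^ n * d ^ 2)); [now apply Rmult_le_compat_l|].
    apply Rle_trans with (r * (INR n ^ 2 * r ^ n * d ^ 2 + INR (S n) * r ^ n * d ^ 2)).
    + apply Rmult_le_compat_l; lra.
    + rewrite S_INR. simpl (r ^ S n).
      assert (0 <= r * r ^ n * d ^ 2).
      { apply Rmult_le_pos; [|apply pow2_ge_0]. apply Rmult_le_pos; [lra|now apply pow_le]. }
      assert (0 <= INR n * (r * r ^ n * d ^ 2)) by (apply Rmult_le_pos; [apply pos_INR|assumption]).
      lra.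
Qed.

(** Summing the first order expansions of the monomials leaves a remainder bounded by
    [|y - z|^2 / r] times the sum of [(n + 1)^2 |a_(n+1)| r^n], where [r < 1] bounds [|y|] and
    [|z|]; that sum is finite because the weights do not change the radius of convergence. *)
Lemma power_series_derivative (F : C -> C) (a : nat -> C) :
  power_series_on_disk F a ->
  (forall z, unit_disk z -> @is_derive C_AbsRing C_NormedModule F z (C_derive F z)) /\
  power_series_on_disk (C_derive F) (fun n => INR (S n) * a (S n))%C.
Proof.
  intros HF.
  pose proof (CV_radius_power_series F a HF) as HR.
  pose (al := fun n => Cmod (a n)). fold al in HR.
  assert (HR1 : Rbar_le 1 (CV_radius (PS_derive al))) by now rewrite CV_radius_derive.
  assert (HR2 : Rbar_le 1 (CV_radius (PS_derive (PS_incr_1 (PS_derive al)))))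
    by now rewrite CV_radius_derive, CV_radius_incr_1.
  assert (Hkey : forall z, unit_disk z -> exists l,
    is_Cseries (fun n => INR (S n) * a (S n) * z ^ n)%C l /\
    @is_derive C_AbsRing C_NormedModule F z l).
  { intros z Hz. unfold unit_disk in Hz. pose proof (Cmod_ge_0 z) as Hz0.
    destruct (@ex_series_le C_AbsRing C_CompleteNormedModule
      (fun n => INR (S n) * a (S n) * z ^ n)%C (fun n => PS_derive al n * Cmod z ^ n)) as [l Hl].
    { intros n. change (Cmod (INR (S n) * a (S n) * z ^ n)%C <= PS_derive al n * Cmod z ^ n).
      rewrite !Cmod_mult, Cmod_pow, Cmod_R, Rabs_pos_eq by apply pos_INR. right. reflexivity. }
    { apply ex_series_inside; [assumption|lra]. }
    exists l. split; [exact Hl|].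
    (* halfway to the unit circle: a radius valid for all [y] near [z] *)
    pose (r := (1 + Cmod z) / 2).
    pose (be := PS_derive (PS_incr_1 (PS_derive al))).
    assert (Hbe : ex_series (fun n => be n * r ^ n)) by (apply ex_series_inside; [assumption|unfold r; lra]).
    apply (is_C_derive_of_quadratic F z l (r - Cmod z) (/ r * Series (fun n => be n * r ^ n))).
    { unfold r; lra. }
    intros y Hy.
    assert (Hyr : Cmod y <= r).
    { replace y with ((y - z) + z)%C by ring. eapply Rle_trans; [apply Cmod_triangle|]. lra. }
    assert (Hr : 0 < r < 1) by (unfold r; lra).
    pose (u := fun n => (a (S n) * (y ^ S n - z ^ S n - (y - z) * (INR (S n) * z ^ n)))%C).
    assert (Hu : is_Cseries u (F y - F z - (y - z) * l)%C).
    { apply is_series_ext with (a := fun n =>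
        (a (S n) * y ^ S n - a (S n) * z ^ S n - (y - z) * (INR (S n) * a (S n) * z ^ n))%C).
      { intros n. unfold u. cring. }
      apply is_Cseries_minus; [|now apply is_Cseries_mult_l].
      apply (@is_series_incr_1 C_AbsRing C_NormedModule (fun n => a n * y ^ n - a n * z ^ n)%C).
      change (is_Cseries (fun n => a n * y ^ n - a n * z ^ n)%C
        (F y - F z + (a 0%nat * y ^ 0 - a 0%nat * z ^ 0))%C).
      replace (F y - F z + (a 0%nat * y ^ 0 - a 0%nat * z ^ 0))%C with (F y - F z)%C by (simpl; ring).
      apply is_Cseries_minus; apply is_pseries_C, HF; unfold unit_disk; lra. }
    assert (Hub : forall n, Cmod (u n) <= / r * Cmod (y - z)%C ^ 2 * (be n * r ^ n)).
    { intros n. unfold u. rewrite Cmod_mult.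
      pose proof (Cmod_pow_taylor_le y z r n Hyr ltac:(unfold r; lra)) as HT.
      apply (Rmult_le_reg_l r); [lra|].
      replace (r * (/ r * Cmod (y - z)%C ^ 2 * (be n * r ^ n)))
        with (Cmod (y - z)%C ^ 2 * (be n * r ^ n)) by (field; lra).
      change (be n) with (INR (S n) * (INR (S n) * Cmod (a (S n)))).
      pose proof (Cmod_ge_0 (a (S n))) as Ha.
      apply Rle_trans with (Cmod (a (S n)) * (INR n ^ 2 * r ^ n * Cmod (y - z)%C ^ 2)); [nra|].
      assert (Hd : 0 <= Cmod (a (S n)) * r ^ n * Cmod (y - z)%C ^ 2).
      { apply Rmult_le_pos; [|apply pow2_ge_0]. apply Rmult_le_pos; [assumption|apply pow_le; lra]. }
      assert (Hi : INR n ^ 2 <= INR (S n) ^ 2).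
      { rewrite S_INR. pose proof (pos_INR n). nra. }
      nra. }
    assert (Hex : ex_series (fun n => / r * Cmod (y - z)%C ^ 2 * (be n * r ^ n)))
      by exact (@ex_series_scal_l R_AbsRing R_NormedModule _ _ Hbe).
    assert (Hexu : ex_series (fun n => Cmod (u n))).
    { now apply ex_series_Cmod_le with (2 := Hex). }
    eapply Rle_trans; [apply (Cmod_series_le u _ Hu Hexu)|].
    replace (/ r * Series (fun n => be n * r ^ n) * Cmod (y - z)%C ^ 2)
      with (/ r * Cmod (y - z)%C ^ 2 * Series (fun n => be n * r ^ n)) by ring.
    rewrite <- Series_scal_l. apply Series_le; [|exact Hex].
    intros n. split; [apply Cmod_ge_0|apply Hub]. }
  split; intros z Hz; destruct (Hkey z Hz) as (l & Hl & HD);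
    rewrite (is_C_derive_unique F z l HD); [exact HD|].
  now apply is_pseries_C.
Qed.

Lemma exists_sqrt_below_1 (r : R) : 0 <= r < 1 -> exists s, 0 <= s < 1 /\ s ^ 2 = r.
Proof.
  intros Hr. exists (sqrt r). split; [split; [apply sqrt_pos|]|apply pow2_sqrt; lra].
  rewrite <- sqrt_1. now apply sqrt_lt_1_alt.
Qed.

(** Parseval applied to [g'] and [k h'] on the circle of radius [s = sqrt r]. *)
Lemma l2_derivative_comparison (h g : C -> C) (a b : nat -> C) (k : R) (r : R) :
  power_series_on_disk h a -> power_series_on_disk g b -> 0 <= k ->
  (forall z, unit_disk z -> Cmod (C_derive g z) <= k * Cmod (C_derive h z)) ->
  0 <= r < 1 ->
  Series (fun n => (INR (S n) * Cmod (b (S n))) ^ 2 * r ^ n)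
  <= k ^ 2 * Series (fun n => (INR (S n) * Cmod (a (S n))) ^ 2 * r ^ n).
Proof.
  intros Hh Hg Hk Hle Hr.
  destruct (power_series_derivative h a Hh) as [_ Hh'].
  destruct (power_series_derivative g b Hg) as [_ Hg'].
  destruct (exists_sqrt_below_1 r Hr) as (s & Hs & Hsr).
  assert (Hmod : forall (c : nat -> C) (t : R) n, 0 <= t -> Cmod (t * (INR (S n) * c (S n) * s ^ n))%C = t * (INR (S n) * Cmod (c (S n)) * s ^ n)).
  { intros c t n Ht. rewrite !Cmod_mult, Cmod_pow, !Cmod_R, (Rabs_pos_eq s), (Rabs_pos_eq (INR (S n))), (Rabs_pos_eq t); try lra. apply pos_INR. }
  assert (Hser : forall (F : C -> C) (c : nat -> C) (t : R), 0 <= t ->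
    power_series_on_disk F (fun n => INR (S n) * c (S n))%C ->
    ex_series (fun n => Cmod (t * (INR (S n) * c (S n) * s ^ n))%C) /\
    forall x, Cmod x = 1 -> is_Cseries (fun n => t * (INR (S n) * c (S n) * s ^ n) * x ^ n)%C (t * F (s * x))%C).
  { intros F c t Ht HF. split.
    - apply ex_series_ext with (a := fun n => t * (Cmod (INR (S n) * c (S n))%C * s ^ n)).
      { intros n. rewrite Hmod by assumption. rewrite Cmod_mult, Cmod_R, Rabs_pos_eq by apply pos_INR. reflexivity. }
      apply (@ex_series_scal_l R_AbsRing R_NormedModule).
      apply (ex_series_inside (fun n => Cmod (INR (S n) * c (S n))%C)); [|exact Hs].
      now apply (CV_radius_power_series F).
    - intros x Hx. apply is_series_ext with (a := fun n => (t * (INR (S n) * c (S n) * (s * x) ^ n))%C).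
      { intros n. rewrite Cpow_mult_l. cring. }
      apply is_Cseries_mult_l, is_pseries_C, HF.
      unfold unit_disk. rewrite Cmod_mult, Hx, Cmod_R, Rabs_pos_eq; lra. }
  destruct (Hser _ b 1 ltac:(lra) Hg') as [Hb1 Hb2].
  destruct (Hser _ a k Hk Hh') as [Ha1 Ha2].
  pose proof (l2_norm_monotone _ _ _ _ Hb1 Ha1 Hb2 Ha2) as H.
  rewrite <- Series_scal_l.
  rewrite (Series_ext _ (fun n => Cmod (1 * (INR (S n) * b (S n) * s ^ n))%C ^ 2)).
  2:{ intros n. rewrite (Hmod b 1 n) by lra.
      rewrite <- Hsr, <- pow_mult, Nat.mul_comm, pow_mult. ring. }
  rewrite (Series_ext (fun n => k ^ 2 * _) (fun n => Cmod (k * (INR (S n) * a (S n) * s ^ n))%C ^ 2)).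
  2:{ intros n. rewrite Hmod by assumption.
      rewrite <- Hsr, <- pow_mult, Nat.mul_comm, pow_mult. ring. }
  apply H. intros x Hx.
  rewrite !Cmod_mult, Cmod_1, Rmult_1_l, Cmod_R, (Rabs_pos_eq k) by assumption.
  apply Hle. unfold unit_disk. rewrite Cmod_mult, Hx, Cmod_R, Rabs_pos_eq; lra.
Qed.

(** * From the dilatation bound to the coefficients *)

(** The weighted series is the derivative of [r] times the unweighted one, and that product
    vanishes at [0]; so this is one integration over [[0, r]]. *)
Lemma PSeries_nonpos_of_weighted (e : nat -> R) :
  Rbar_le 1 (CV_radius e) ->
  (forall r, 0 <= r < 1 -> Series (fun n => INR (S n) * e n * r ^ n) <= 0) ->
  forall r, 0 <= r < 1 -> Series (fun n => e n * r ^ n) <= 0.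
Proof.
  intros Hcv H r Hr.
  destruct (Req_dec r 0) as [->|Hr0].
  - specialize (H 0 ltac:(lra)).
    change (PSeries (fun n => INR (S n) * e n) 0 <= 0) in H.
    change (PSeries e 0 <= 0). rewrite PSeries_0 in *. simpl in H. lra.
  - assert (Hin : forall x, 0 <= x < 1 -> Rbar_lt (Rabs x) (CV_radius (PS_incr_1 e))).
    { intros x Hx. rewrite CV_radius_incr_1.
      eapply Rbar_lt_le_trans; [|exact Hcv]. simpl. rewrite Rabs_pos_eq; lra. }
    destruct (MVT_gen (PSeries (PS_incr_1 e)) 0 r (PSeries (PS_derive (PS_incr_1 e))))
      as (x & Hx & Heq).
    + intros x. rewrite Rmin_left, Rmax_right by lra. intros Hx.
      apply is_derive_PSeries, Hin. lra.
    + intros x. rewrite Rmin_left, Rmax_right by lra. intros Hx.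
      apply PSeries_continuity, Hin. lra.
    + rewrite Rmin_left, Rmax_right in Hx by lra.
      specialize (H x ltac:(lra)).
      change (PSeries (PS_derive (PS_incr_1 e)) x <= 0) in H.
      rewrite !PSeries_incr_1 in Heq.
      change (PSeries e r <= 0). nra.
Qed.

Lemma CV_radius_sqr_minus (u v : nat -> R) (k : R) :
  (forall n, 0 <= u n) -> (forall n, 0 <= v n) ->
  Rbar_le 1 (CV_radius u) -> Rbar_le 1 (CV_radius v) ->
  Rbar_le 1 (CV_radius (fun n => v n ^ 2 - k ^ 2 * u n ^ 2)).
Proof.
  intros Hu Hv Ru Rv. apply CV_radius_ge_1. intros r Hr.
  destruct (exists_sqrt_below_1 r Hr) as (s & Hs & Hsr).
  assert (Hpos : forall n, 0 <= s ^ n) by (intros n; apply pow_le; lra).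
  exists ((Series (fun n => v n * s ^ n)) ^ 2 + k ^ 2 * (Series (fun n => u n * s ^ n)) ^ 2).
  intros n.
  assert (Hun : 0 <= u n * s ^ n <= Series (fun n => u n * s ^ n)).
  { split; [now apply Rmult_le_pos|].
    apply (term_le_Series (fun n => u n * s ^ n)); [intros i; now apply Rmult_le_pos|].
    now apply ex_series_inside. }
  assert (Hvn : 0 <= v n * s ^ n <= Series (fun n => v n * s ^ n)).
  { split; [now apply Rmult_le_pos|].
    apply (term_le_Series (fun n => v n * s ^ n)); [intros i; now apply Rmult_le_pos|].
    now apply ex_series_inside. }
  replace ((v n ^ 2 - k ^ 2 * u n ^ 2) * r ^ n) with ((v n * s ^ n) ^ 2 - k ^ 2 * (u n * s ^ n) ^ 2).
  2:{ rewrite <- Hsr, <- pow_mult, Nat.mul_comm, pow_mult. ring. }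
  pose proof (pow_incr _ _ 2 Hun) as Pu. pose proof (pow_incr _ _ 2 Hvn) as Pv.
  pose proof (pow2_ge_0 k) as Pk. pose proof (pow2_ge_0 (u n * s ^ n)). pose proof (pow2_ge_0 (v n * s ^ n)).
  assert (0 <= k ^ 2 * (u n * s ^ n) ^ 2) by now apply Rmult_le_pos.
  assert (k ^ 2 * (u n * s ^ n) ^ 2 <= k ^ 2 * (Series (fun n => u n * s ^ n)) ^ 2) by now apply Rmult_le_compat_l.
  apply Rabs_le. lra.
Qed.

(** Both sides are gathered into the single power series with coefficients
    [|b_(n+1)|^2 - k^2 |a_(n+1)|^2]; with weights [(n + 1)^2] it is nonpositive by
    [l2_derivative_comparison], and [PSeries_nonpos_of_weighted] removes one factor [n + 1]
    at a time. *)
Lemma l2_comparison (h g : C -> C) (a b : nat -> C) (k : R) (r : R) :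
  power_series_on_disk h a -> power_series_on_disk g b -> 0 <= k ->
  (forall z, unit_disk z -> Cmod (C_derive g z) <= k * Cmod (C_derive h z)) ->
  0 <= r < 1 ->
  ex_series (fun n => Cmod (b (S n)) ^ 2 * r ^ n) /\
  Series (fun n => Cmod (b (S n)) ^ 2 * r ^ n) <= k ^ 2 * Series (fun n => Cmod (a (S n)) ^ 2 * r ^ n).
Proof.
  intros Hh Hg Hk Hle Hr.
  pose (u := fun n => Cmod (a (S n))). pose (v := fun n => Cmod (b (S n))).
  assert (Hu : forall n, 0 <= u n) by (intros; apply Cmod_ge_0).
  assert (Hv : forall n, 0 <= v n) by (intros; apply Cmod_ge_0).
  assert (Ru : Rbar_le 1 (CV_radius u)).
  { change u with (PS_decr_1 (fun n => Cmod (a n))). rewrite CV_radius_decr_1.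
    now apply (CV_radius_power_series h). }
  assert (Rv : Rbar_le 1 (CV_radius v)).
  { change v with (PS_decr_1 (fun n => Cmod (b n))). rewrite CV_radius_decr_1.
    now apply (CV_radius_power_series g). }
  assert (Hw : forall c, Rbar_le 1 (CV_radius c) -> Rbar_le 1 (CV_radius (fun n => INR (S n) * c n))).
  { intros c Hc. change (fun n => INR (S n) * c n) with (PS_derive (PS_incr_1 c)).
    now rewrite CV_radius_derive, CV_radius_incr_1. }
  assert (Hsqr : forall w, (forall n, 0 <= w n) -> Rbar_le 1 (CV_radius w) -> Rbar_le 1 (CV_radius (fun n => w n ^ 2))).
  { intros w Hw0 Rw.
    rewrite (CV_radius_ext _ (fun n => w n ^ 2 - 0 ^ 2 * w n ^ 2)) by (intros; ring).
    now apply CV_radius_sqr_minus. }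
  assert (Hminus : forall (p q : nat -> R) s, 0 <= s < 1 -> Rbar_le 1 (CV_radius p) -> Rbar_le 1 (CV_radius q) ->
     Series (fun n => (q n - k ^ 2 * p n) * s ^ n)
     = Series (fun n => q n * s ^ n) - k ^ 2 * Series (fun n => p n * s ^ n)).
  { intros p q s Hs Rp Rq. rewrite <- Series_scal_l, <- Series_minus.
    - apply Series_ext. intros n. ring.
    - now apply ex_series_inside.
    - apply (@ex_series_scal_l R_AbsRing R_NormedModule). now apply ex_series_inside. }
  split; [apply (ex_series_inside (fun n => v n ^ 2)); auto|].
  assert (Hd := CV_radius_sqr_minus u v k Hu Hv Ru Rv).
  enough (H : Series (fun n => (v n ^ 2 - k ^ 2 * u n ^ 2) * r ^ n) <= 0).
  { rewrite (Hminus (fun n => u n ^ 2) (fun n => v n ^ 2)) in H by auto. unfold u, v in H. lra. }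
  revert r Hr. apply PSeries_nonpos_of_weighted; [exact Hd|].
  apply PSeries_nonpos_of_weighted; [now apply Hw|].
  intros r Hr.
  pose proof (l2_derivative_comparison h g a b k r Hh Hg Hk Hle Hr) as H.
  rewrite (Series_ext _ (fun n => ((INR (S n) * v n) ^ 2 - k ^ 2 * (INR (S n) * u n) ^ 2) * r ^ n))
    by (intros n; ring).
  rewrite (Hminus (fun n => (INR (S n) * u n) ^ 2) (fun n => (INR (S n) * v n) ^ 2)).
  - unfold u, v. lra.
  - exact Hr.
  - apply (Hsqr (fun n => INR (S n) * u n)); [intros n; apply Rmult_le_pos; [apply pos_INR|auto]|auto].
  - apply (Hsqr (fun n => INR (S n) * v n)); [intros n; apply Rmult_le_pos; [apply pos_INR|auto]|auto].
Qed.

(** Cauchy-Schwarz against the geometric series, in the form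
    [v <= v^2 / (2 x) + x / 2].  The choice [x = s] would be optimal; any [x > s] is used
    instead, to cover [s = 0]. *)
Lemma Series_le_of_l2 (v : nat -> R) (s r : R) :
  (forall n, 0 <= v n) -> 0 <= s -> 0 <= r < 1 ->
  ex_series (fun n => v n ^ 2 * r ^ n) ->
  Series (fun n => v n ^ 2 * r ^ n) <= s ^ 2 / (1 - r) ->
  Series (fun n => v n * r ^ n) <= s / (1 - r).
Proof.
  intros Hv Hs Hr Hex Hle.
  assert (Hr1 : Rabs r < 1) by (rewrite Rabs_pos_eq; lra).
  assert (Hi : 0 < / (1 - r)) by (apply Rinv_0_lt_compat; lra).
  assert (Hx : forall x, s < x -> Series (fun n => v n * r ^ n) <= x / (1 - r)).
  { intros x Hx.
    apply Rle_trans with (/ (2 * x) * Series (fun n => v n ^ 2 * r ^ n) + x / 2 * Series (fun n => r ^ n)).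
    - rewrite <- !Series_scal_l, <- Series_plus.
      2: exact (@ex_series_scal_l R_AbsRing R_NormedModule _ _ Hex).
      2: exact (@ex_series_scal_l R_AbsRing R_NormedModule _ _ (ex_series_geom r Hr1)).
      apply Series_le.
      + intros n. pose proof (Hv n) as Hvn. assert (Hp : 0 <= r ^ n) by (apply pow_le; lra).
        split; [now apply Rmult_le_pos|].
        replace (/ (2 * x) * (v n ^ 2 * r ^ n) + x / 2 * r ^ n)
          with ((/ (2 * x) * v n ^ 2 + x / 2) * r ^ n) by ring.
        apply Rmult_le_compat_r; [assumption|].
        assert (E : / (2 * x) * v n ^ 2 + x / 2 - v n = / (2 * x) * (v n - x) ^ 2) by (field; lra).
        assert (0 <= / (2 * x) * (v n - x) ^ 2); [|lra].
        apply Rmult_le_pos; [left; apply Rinv_0_lt_compat; lra|apply pow2_ge_0].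
      + apply (@ex_series_plus R_AbsRing R_NormedModule).
        * exact (@ex_series_scal_l R_AbsRing R_NormedModule _ _ Hex).
        * exact (@ex_series_scal_l R_AbsRing R_NormedModule _ _ (ex_series_geom r Hr1)).
    - rewrite Series_geom by assumption.
      assert (H2 : Series (fun n => v n ^ 2 * r ^ n) <= x ^ 2 / (1 - r)).
      { eapply Rle_trans; [exact Hle|]. apply Rmult_le_compat_r; [lra|]. apply pow_incr. lra. }
      apply Rle_trans with (/ (2 * x) * (x ^ 2 / (1 - r)) + x / 2 * / (1 - r)).
      + apply Rplus_le_compat_r, Rmult_le_compat_l; [|assumption].
        left. apply Rinv_0_lt_compat. lra.
      + right. field. lra. }
  apply le_epsilon. intros eps Heps.
  specialize (Hx (s + eps * (1 - r)) ltac:(nra)).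
  replace (s / (1 - r) + eps) with ((s + eps * (1 - r)) / (1 - r)) by (field; lra).
  exact Hx.
Qed.

Lemma Series_le_geometric (c : nat -> R) (M r : R) :
  (forall n, 0 <= c n <= M) -> 0 <= r < 1 ->
  Series (fun n => c n * r ^ n) <= M / (1 - r).
Proof.
  intros Hc Hr. assert (Hr1 : Rabs r < 1) by (rewrite Rabs_pos_eq; lra).
  unfold Rdiv. rewrite <- (Series_geom r Hr1), <- Series_scal_l.
  apply Series_le.
  - intros n. assert (0 <= r ^ n) by (apply pow_le; lra). specialize (Hc n). nra.
  - exact (@ex_series_scal_l R_AbsRing R_NormedModule _ _ (ex_series_geom r Hr1)).
Qed.

Lemma Series_split_head (c : nat -> R) (r : R) :
  Rbar_le 1 (CV_radius c) -> 0 <= r < 1 ->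
  Series (fun n => c n * r ^ n) = c 0%nat + r * Series (fun n => c (S n) * r ^ n).
Proof.
  intros Hc Hr. rewrite Series_incr_1 by now apply ex_series_inside.
  rewrite <- Series_scal_l. simpl (r ^ 0). rewrite Rmult_1_r. f_equal.
  apply Series_ext. intros n. simpl. ring.
Qed.

(** * The equation defining the radius *)

(** With [k = (K - 1) / (K + 1)] the factor [2 K / (K + 1)] is [1 + k]: the [1] will account
    for the coefficients of [h] and the [k] for those of [g]. *)
Lemma D_fun_split (K t : R) (m : nat) (r : R) : 1 <= K -> r < 1 ->
  D_fun K t m r = t * (r ^ m / (1 - r ^ m)) + (1 - t) * ((1 + (K - 1) / (K + 1)) * (r / (1 - r))) - 1 / 2.
Proof. intros HK Hr. unfold D_fun. unfold Rdiv. rewrite Rmult_assoc. f_equal. f_equal. field. lra. Qed.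

Lemma div_1_minus_lt (x y : R) : x < y < 1 -> x / (1 - x) < y / (1 - y).
Proof.
  intros H. replace (x / (1 - x)) with (/ (1 - x) - 1) by (field; lra).
  replace (y / (1 - y)) with (/ (1 - y) - 1) by (field; lra).
  apply Rplus_lt_compat_r, Rinv_lt_contravar; [apply Rmult_lt_0_compat|]; lra.
Qed.

Lemma pow_unit_interval (r : R) (m : nat) : (1 <= m)%nat -> 0 <= r < 1 -> 0 <= r ^ m < 1.
Proof.
  intros Hm Hr. split; [apply pow_le; lra|].
  destruct m as [|m]; [lia|]. simpl.
  assert (0 <= r ^ m <= 1).
  { split; [apply pow_le; lra|]. rewrite <- (pow1 m). apply pow_incr. lra. }
  nra.
Qed.

Lemma D_fun_increasing (K t : R) (m : nat) (r s : R) :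
  1 <= K -> 0 <= t <= 1 -> (1 <= m)%nat -> 0 <= r < s -> s < 1 ->
  D_fun K t m r < D_fun K t m s.
Proof.
  intros HK Ht Hm Hr Hs. rewrite !D_fun_split by lra.
  assert (Hk : 0 <= (K - 1) / (K + 1)) by (apply Rdiv_le_0_compat; lra).
  assert (HB : r / (1 - r) < s / (1 - s)) by (apply div_1_minus_lt; lra).
  assert (HA : r ^ m / (1 - r ^ m) < s ^ m / (1 - s ^ m)).
  { apply div_1_minus_lt. split; [|apply pow_unit_interval; [assumption|lra]].
    destruct m as [|m]; [lia|]. simpl. assert (0 <= r ^ m <= s ^ m) by (split; [apply pow_le; lra|apply pow_incr; lra]).
    assert (0 < s ^ m) by (apply pow_lt; lra). nra. }
  set (A := r ^ m / (1 - r ^ m)) in *. set (A' := s ^ m / (1 - s ^ m)) in *.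
  set (B := r / (1 - r)) in *. set (B' := s / (1 - s)) in *. set (k := (K - 1) / (K + 1)) in *.
  assert (HB' : (1 + k) * B < (1 + k) * B') by (apply Rmult_lt_compat_l; lra).
  destruct (Req_dec t 0) as [->|Ht0]; [lra|].
  assert (t * A < t * A') by (apply Rmult_lt_compat_l; lra).
  assert ((1 - t) * ((1 + k) * B) <= (1 - t) * ((1 + k) * B')) by (apply Rmult_le_compat_l; lra).
  lra.
Qed.

Lemma D_root_unique (K t : R) (m : nat) :
  1 <= K -> 0 <= t <= 1 -> (1 <= m)%nat -> exists! r, D_root K t m r.
Proof.
  intros HK Ht Hm.
  assert (HmR : 1 <= INR m) by (change 1 with (INR 1); apply le_INR, Hm).
  (* By Bernoulli's inequality [r1^m >= 1/2], so both fractions in [D] are at least [1]. *)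
  set (r1 := 1 - / (2 * INR m)).
  assert (Hi : 0 < / (2 * INR m) <= / 2).
  { split; [apply Rinv_0_lt_compat; lra|]. apply Rinv_le_contravar; lra. }
  assert (Hr1 : 1 / 2 <= r1 < 1) by (unfold r1; lra).
  assert (Hge : forall x, 1 / 2 <= x < 1 -> 1 <= x / (1 - x)).
  { intros x Hx. apply (Rmult_le_reg_r (1 - x)); [lra|]. unfold Rdiv.
    rewrite Rmult_assoc, Rinv_l; lra. }
  assert (Hpow : 1 / 2 <= r1 ^ m).
  { pose proof (bernoulli_le r1 m ltac:(lra)) as Hb.
    replace (1 - INR m * (1 - r1)) with (1 / 2) in Hb by (unfold r1; field; lra). exact Hb. }
  assert (Hk : 0 <= (K - 1) / (K + 1)) by (apply Rdiv_le_0_compat; lra).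
  assert (Hpos : 0 < D_fun K t m r1).
  { rewrite D_fun_split by lra.
    assert (HA : 1 <= r1 ^ m / (1 - r1 ^ m))
      by (apply Hge; split; [assumption|apply pow_unit_interval; [assumption|lra]]).
    assert (HB : 1 <= r1 / (1 - r1)) by (apply Hge; lra).
    set (A := r1 ^ m / (1 - r1 ^ m)) in *. set (B := r1 / (1 - r1)) in *.
    set (k := (K - 1) / (K + 1)) in *.
    assert (1 <= (1 + k) * B) by nra.
    assert (t <= t * A) by nra.
    assert (1 - t <= (1 - t) * ((1 + k) * B)) by nra. lra. }
  assert (Hneg : D_fun K t m 0 < 0).
  { rewrite D_fun_split by lra. rewrite pow_i by lia. unfold Rdiv. lra. }
  destruct (IVT_interv (D_fun K t m) 0 r1) as (x & Hx & Hx0); try assumption; try lra.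
  - intros x Hx. apply continuity_pt_filterlim.
    apply (@ex_derive_continuous R_AbsRing R_NormedModule). unfold D_fun. auto_derive.
    pose proof (pow_unit_interval x m Hm ltac:(lra)).
    repeat split; try lra. apply Rmult_integral_contrapositive_currified; lra.
  - exists x. assert (Hxr : 0 < x < 1).
    { split; [|lra]. destruct (Req_dec x 0) as [E|]; [|lra]. rewrite E in Hx0. lra. }
    split; [now split|]. intros y [Hy Hy0].
    destruct (Rtotal_order x y) as [Hlt|[Heq|Hlt]]; [|exact Heq|].
    + pose proof (D_fun_increasing K t m x y HK Ht Hm ltac:(lra) ltac:(lra)). lra.
    + pose proof (D_fun_increasing K t m y x HK Ht Hm ltac:(lra) ltac:(lra)). lra.
Qed.

(** * The Bohr inequality *)

Lemma quasiconformal_derivative_bound (K : R) (f h g : C -> C) :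
  sense_preserving_quasiconformal K f h g ->
  forall z, unit_disk z -> Cmod (C_derive g z) <= (K - 1) / (K + 1) * Cmod (C_derive h z).
Proof.
  intros (_ & Hlu & Hq) z Hz. destruct (Hlu z Hz) as [Hh _].
  specialize (Hq z Hz). unfold dilatation in Hq. rewrite Cmod_div in Hq by assumption.
  apply Cmod_gt_0 in Hh.
  apply (Rmult_le_compat_r (Cmod (C_derive h z))) in Hq; [|lra].
  unfold Rdiv in Hq at 1. rewrite Rmult_assoc, Rinv_l, Rmult_1_r in Hq by lra. exact Hq.
Qed.

(** The quantity [d] enters only through [|a_n| <= 2 d]: the constant term contributes
    [|a_0|] to both halves, and the remaining geometric sums are [2 d] times
    [D(r) + 1/2]. *)
Lemma bohr_bound (K t : R) (m : nat) (f h g : C -> C) (a b : nat -> C) (d : R) (z : C) :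
  1 <= K -> 0 <= t <= 1 -> (1 <= m)%nat ->
  sense_preserving_quasiconformal K f h g ->
  power_series_on_disk h a -> power_series_on_disk g b -> b 0%nat = RtoC 0 ->
  (forall n, (1 <= n)%nat -> Cmod (a n) <= 2 * d) ->
  unit_disk z ->
  t * Cmod (h (z ^ m)%C) + (1 - t) * Series (fun n => (Cmod (a n) + Cmod (b n)) * Cmod z ^ n)
  <= Cmod (a 0%nat) + d + 2 * d * D_fun K t m (Cmod z).
Proof.
  intros HK Ht Hm Hqc Hh Hg Hb0 Ha Hz.
  assert (Hr : 0 <= Cmod z < 1) by (split; [apply Cmod_ge_0|exact Hz]).
  set (r := Cmod z) in *. set (k := (K - 1) / (K + 1)).
  assert (Hk : 0 <= k) by (apply Rdiv_le_0_compat; lra).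
  pose proof (CV_radius_power_series h a Hh) as Ra.
  pose proof (CV_radius_power_series g b Hg) as Rb.
  assert (Ha' : forall n, 0 <= Cmod (a (S n)) <= 2 * d)
    by (intros n; split; [apply Cmod_ge_0|apply Ha; lia]).
  assert (Hd : 0 <= d) by (specialize (Ha' 0%nat); lra).
  assert (HA : forall x, 0 <= x < 1 ->
    Series (fun n => Cmod (a n) * x ^ n) <= Cmod (a 0%nat) + 2 * d * (x / (1 - x))).
  { intros x Hx. rewrite Series_split_head by assumption.
    replace (2 * d * (x / (1 - x))) with (x * (2 * d / (1 - x))) by (field; lra).
    apply Rplus_le_compat_l, Rmult_le_compat_l; [lra|]. now apply Series_le_geometric. }
  assert (HB : Series (fun n => Cmod (b n) * r ^ n) <= 2 * d * (k * (r / (1 - r)))).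
  { rewrite Series_split_head, Hb0, Cmod_0, Rplus_0_l by assumption.
    replace (2 * d * (k * (r / (1 - r)))) with (r * (k * (2 * d) / (1 - r))) by (field; lra).
    apply Rmult_le_compat_l; [lra|].
    destruct (l2_comparison h g a b k r Hh Hg Hk (quasiconformal_derivative_bound K f h g Hqc) Hr)
      as [Hex Hle].
    apply Series_le_of_l2; auto.
    - intros n. apply Cmod_ge_0.
    - nra.
    - eapply Rle_trans; [exact Hle|].
      replace ((k * (2 * d)) ^ 2 / (1 - r)) with (k ^ 2 * ((2 * d) ^ 2 / (1 - r))) by (field; lra).
      apply Rmult_le_compat_l; [apply pow2_ge_0|].
      apply (Series_le_geometric (fun n => Cmod (a (S n)) ^ 2)); [|assumption].
      intros n. split; [apply pow2_ge_0|]. now apply pow_incr. }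
  assert (Hhm : Cmod (h (z ^ m)%C) <= Series (fun n => Cmod (a n) * (r ^ m) ^ n)).
  { pose proof (pow_unit_interval r m Hm Hr) as Hrm.
    assert (Hzm : unit_disk (z ^ m)%C) by (unfold unit_disk; rewrite Cmod_pow; apply Hrm).
    assert (E : forall n, Cmod (a n * (z ^ m) ^ n)%C = Cmod (a n) * (r ^ m) ^ n)
      by (intros n; now rewrite Cmod_mult, !Cmod_pow).
    rewrite <- (Series_ext _ _ E). apply Cmod_series_le.
    - apply is_pseries_C, Hh, Hzm.
    - eapply ex_series_ext; [intros n; symmetry; apply E|].
      now apply (ex_series_inside (fun n => Cmod (a n))). }
  assert (HAB : Series (fun n => (Cmod (a n) + Cmod (b n)) * r ^ n)
    = Series (fun n => Cmod (a n) * r ^ n) + Series (fun n => Cmod (b n) * r ^ n)).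
  { rewrite <- Series_plus.
    - apply Series_ext. intros n. ring.
    - now apply (ex_series_inside (fun n => Cmod (a n))).
    - now apply (ex_series_inside (fun n => Cmod (b n))). }
  rewrite HAB, D_fun_split by lra. fold k.
  pose proof (HA (r ^ m) (pow_unit_interval r m Hm Hr)) as HAm.
  specialize (HA r Hr).
  set (X := r ^ m / (1 - r ^ m)) in *. set (Y := r / (1 - r)) in *.
  assert (H1 : t * Cmod (h (z ^ m)%C) <= t * (Cmod (a 0%nat) + 2 * d * X))
    by (apply Rmult_le_compat_l; lra).
  assert (H2 : (1 - t) * (Series (fun n => Cmod (a n) * r ^ n) + Series (fun n => Cmod (b n) * r ^ n))
    <= (1 - t) * (Cmod (a 0%nat) + 2 * d * Y + 2 * d * (k * Y)))
    by (apply Rmult_le_compat_l; lra).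
  lra.
Qed.

Lemma bohr_inequality_holds (K t : R) (m : nat) (R0 : R) :
  1 <= K -> 0 <= t <= 1 -> (1 <= m)%nat -> D_root K t m R0 ->
  bohr_inequality_up_to K t m R0.
Proof.
  intros HK Ht Hm [HR HD] f h g phi a b Hqc Hh Hg Hb0 (_ & _ & Hconv) Hsub z r Hz <- Hr.
  assert (Ea : a 0%nat = phi (RtoC 0)).
  { rewrite <- (power_series_at_0 h a Hh). now apply subordinate_center. }
  assert (HDz : D_fun K t m (Cmod z) <= 0).
  { destruct (Rle_lt_or_eq_dec _ _ Hr) as [Hlt| ->]; [|lra].
    pose proof (D_fun_increasing K t m (Cmod z) R0 HK Ht Hm
      (conj (Cmod_ge_0 z) Hlt) (proj2 HR)). lra. }
  set (L := t * Cmod (h (z ^ m)%C) + (1 - t) * Series (fun n => (Cmod (a n) + Cmod (b n)) * Cmod z ^ n)).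
  assert (Hlb : Rbar_le (L - Cmod (phi (RtoC 0)))
    (distance_to (phi (RtoC 0)) (boundary (disk_image phi)))).
  { apply (proj2 (Glb_Rbar_correct _)). intros x (q & Hq & ->). simpl.
    pose proof (bohr_bound K t m f h g a b (Cmod (phi (RtoC 0) - q)%C) z HK Ht Hm Hqc Hh Hg Hb0
      (fun n Hn => convex_subordination_coefficient_bound h phi a q n Hh Hconv Hsub Hq Hn) Hz) as H.
    fold L in H. rewrite Ea in H. pose proof (Cmod_ge_0 (phi (RtoC 0) - q)%C). nra. }
  destruct (distance_to _ _); simpl in *; auto; lra.
Qed.

(** * Sharpness *)

Lemma bohr_inequality_up_to_le (K t : R) (m : nat) (rho rho' : R) :
  rho <= rho' -> bohr_inequality_up_to K t m rho' -> bohr_inequality_up_to K t m rho.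
Proof.
  intros Hle H f h g phi a b Hqc Hh Hg Hb Hphi Hsub z r Hz Hr Hrho.
  apply (H f h g phi a b); auto; lra.
Qed.

(** The extremal functions are members of this family: [h = phi] for [c = 1], [e = 0], and
    [g = k z / (1 - z)] for [c = k], [e = - k]. *)
Definition cauchy_kernel (c e z : C) : C := (c / (1 - z) + e)%C.

Lemma one_minus_neq_0 (z : C) : unit_disk z -> (1 - z)%C <> RtoC 0.
Proof.
  intros Hz E. assert (E1 : z = RtoC 1) by (replace z with (1 - (1 - z))%C by ring; rewrite E; ring).
  unfold unit_disk in Hz. rewrite E1, Cmod_1 in Hz. lra.
Qed.

(** The remainder of [1 / (1 - z)] is exactly [(y - z)^2 / ((1 - y) (1 - z)^2)], and
    [|1 - y|] stays above [|1 - z| / 2] near [z]. *)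
Lemma is_derive_cauchy_kernel (c e z : C) : unit_disk z ->
  @is_derive C_AbsRing C_NormedModule (cauchy_kernel c e) z (c / (1 - z) ^ 2)%C.
Proof.
  intros Hz. pose proof (one_minus_neq_0 z Hz) as Hz1.
  pose proof (proj1 (Cmod_gt_0 _) Hz1) as Hp.
  apply (is_C_derive_of_quadratic _ _ _ (Cmod (1 - z)%C / 2) (2 * Cmod c / Cmod (1 - z)%C ^ 3)).
  { lra. }
  intros y Hy.
  assert (Hyp : Cmod (1 - z)%C / 2 < Cmod (1 - y)%C).
  { assert (Cmod (1 - z)%C <= Cmod (1 - y)%C + Cmod (y - z)%C); [|lra].
    replace (1 - z)%C with ((1 - y) + (y - z))%C at 1 by ring. apply Cmod_triangle. }
  assert (Hy1 : (1 - y)%C <> RtoC 0) by (apply Cmod_gt_0; lra).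
  replace (cauchy_kernel c e y - cauchy_kernel c e z - (y - z) * (c / (1 - z) ^ 2))%C
    with (c * (y - z) ^ 2 / ((1 - y) * (1 - z) ^ 2))%C.
  2:{ unfold cauchy_kernel. simpl Cpow. field. now split. }
  rewrite Cmod_div by (apply Cmult_neq_0; [assumption|now apply Cpow_nz]).
  rewrite !Cmod_mult, !Cmod_pow.
  set (A := Cmod (1 - z)%C) in *. set (B := Cmod (1 - y)%C) in *.
  replace (Cmod c * Cmod (y - z)%C ^ 2 / (B * A ^ 2))
    with (Cmod c * Cmod (y - z)%C ^ 2 / A ^ 2 * / B) by (field; lra).
  replace (2 * Cmod c / A ^ 3 * Cmod (y - z)%C ^ 2)
    with (Cmod c * Cmod (y - z)%C ^ 2 / A ^ 2 * / (A / 2)) by (field; lra).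
  apply Rmult_le_compat_l.
  - apply Rmult_le_pos; [|left; apply Rinv_0_lt_compat, pow_lt, Hp].
    apply Rmult_le_pos; [apply Cmod_ge_0|apply pow2_ge_0].
  - apply Rinv_le_contravar; lra.
Qed.

Lemma analytic_cauchy_kernel (c e : C) : analytic (cauchy_kernel c e).
Proof. intros z Hz. eexists. now apply is_derive_cauchy_kernel. Qed.

Lemma analytic_id : analytic (fun z => z).
Proof.
  intros z _. exists (RtoC 1 : C_NormedModule).
  apply (is_C_derive_of_quadratic _ _ _ 1 0); [lra|]. intros y _.
  replace (y - z - (y - z) * 1)%C with (RtoC 0) by ring. rewrite Cmod_0. lra.
Qed.

Lemma is_Cseries_geom (z : C) : unit_disk z -> is_Cseries (fun n => z ^ n)%C (/ (1 - z))%C.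
Proof.
  intros Hz. pose proof (one_minus_neq_0 z Hz) as Hz1.
  pose proof (proj1 (Cmod_gt_0 _) Hz1) as Hp.
  assert (Hsum : forall n, (sum_n (fun i => z ^ i) n - / (1 - z) = - (z ^ S n / (1 - z)))%C).
  { induction n as [|n IH].
    - rewrite sum_O. simpl Cpow. match goal with |- ?x = ?y => change (@eq C x y) end. field. assumption.
    - rewrite sum_Sn.
      change ((sum_n (fun i => z ^ i) n + z ^ S n) - / (1 - z) = - (z ^ S (S n) / (1 - z)))%C.
      replace (sum_n (fun i => z ^ i) n + z ^ S n - / (1 - z))%C
        with ((sum_n (fun i => z ^ i) n - / (1 - z)) + z ^ S n)%C by cring.
      rewrite IH, !Cpow_S. field. assumption. }
  apply is_series_Cmod. intros eps Heps.
  assert (Hgeo : is_lim_seq (fun n => Cmod z ^ n) 0).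
  { apply is_lim_seq_geom. rewrite Rabs_pos_eq; [exact Hz|apply Cmod_ge_0]. }
  apply is_lim_seq_spec in Hgeo.
  assert (He : 0 < eps * Cmod (1 - z)%C) by now apply Rmult_lt_0_compat.
  destruct (Hgeo (mkposreal _ He)) as [N HN].
  exists N. intros n Hn. rewrite Hsum, Cmod_opp, Cmod_div, Cmod_pow by assumption.
  specialize (HN (S n) ltac:(lia)). simpl pos in HN.
  rewrite Rminus_0_r, Rabs_pos_eq in HN by (apply pow_le, Cmod_ge_0).
  apply (Rmult_lt_reg_r (Cmod (1 - z)%C)); [assumption|].
  unfold Rdiv. rewrite Rmult_assoc, Rinv_l by lra. lra.
Qed.

Lemma power_series_cauchy_kernel (c e : C) :
  power_series_on_disk (cauchy_kernel c e) (fun n => c + if Nat.eqb n 0 then e else 0)%C.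
Proof.
  intros z Hz. apply is_pseries_C.
  apply is_series_ext with (a := fun n => (c * z ^ n + if Nat.eqb n 0 then e else 0)%C).
  - intros n. destruct (Nat.eqb_spec n 0) as [->|]; simpl Cpow; cring.
  - apply is_Cseries_plus; [apply is_Cseries_mult_l, is_Cseries_geom, Hz|].
    apply (@is_series_single C_AbsRing C_NormedModule).
Qed.

(** The inverse of [w = 1 / (1 - z)] is [z = (w - 1) / w], and [|w - 1| < |w|] holds exactly
    when [w] is closer to [1] than to [0]. *)
Lemma disk_image_cauchy_kernel (p : C) :
  disk_image (cauchy_kernel 1 0) p <-> 1 / 2 < Re p.
Proof.
  assert (Hsq : forall w : C, w <> RtoC 0 -> (Cmod (w - 1)%C < Cmod w <-> 1 / 2 < Re w)).
  { intros w _.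
    assert (E : Cmod (w - 1)%C ^ 2 = Cmod w ^ 2 + 1 - 2 * Re w)
      by (rewrite !Cmod2_alt; destruct w; simpl; ring).
    pose proof (Cmod_ge_0 (w - 1)%C). pose proof (Cmod_ge_0 w).
    split; intros H1; [nra|].
    apply Rsqr_incrst_0; [|assumption|assumption]. rewrite !Rsqr_pow2. lra. }
  split.
  - intros (z & Hz & ->). pose proof (one_minus_neq_0 z Hz) as Hz1.
    set (w := cauchy_kernel 1 0 z).
    assert (Ew : w = (/ (1 - z))%C) by (unfold w, cauchy_kernel; field; assumption).
    assert (Hw : w <> RtoC 0).
    { rewrite Ew. intros E. apply (C1_nz). replace (RtoC 1) with ((1 - z) * / (1 - z))%C by (field; assumption).
      rewrite E. ring. }
    apply (Hsq w Hw).
    replace (w - 1)%C with (z * w)%C by (rewrite Ew; field; assumption).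
    rewrite Cmod_mult. apply Cmod_gt_0 in Hw. unfold unit_disk in Hz. nra.
  - intros Hp. assert (Hp0 : p <> RtoC 0) by (intros E; rewrite E in Hp; simpl in Hp; lra).
    exists (1 - / p)%C. split.
    + unfold unit_disk. replace (1 - / p)%C with ((p - 1) / p)%C by (field; assumption).
      rewrite Cmod_div by assumption.
      pose proof (proj2 (Hsq p Hp0) Hp) as H. apply Cmod_gt_0 in Hp0.
      apply (Rmult_lt_reg_r (Cmod p)); [assumption|].
      unfold Rdiv. rewrite Rmult_assoc, Rinv_l by lra. lra.
    + unfold cauchy_kernel. replace (1 - (1 - / p))%C with (/ p)%C by ring.
      field. assumption.
Qed.

Lemma convex_function_cauchy_kernel : convex_function (cauchy_kernel 1 0).
Proof.
  split; [apply analytic_cauchy_kernel|split].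
  - intros z1 z2 H1 H2 E. unfold cauchy_kernel in E.
    pose proof (one_minus_neq_0 z1 H1). pose proof (one_minus_neq_0 z2 H2).
    replace z1 with (1 - (1 - z1) * (1 - z2) * (1 / (1 - z2) + 0))%C by (field; assumption).
    rewrite <- E. field. assumption.
  - intros p q s Hp Hq Hs. apply disk_image_cauchy_kernel in Hp. apply disk_image_cauchy_kernel in Hq.
    apply disk_image_cauchy_kernel. destruct p as [p1 p2], q as [q1 q2]. simpl in *.
    destruct (Req_dec s 1) as [->|]; nra.
Qed.

Lemma distance_cauchy_kernel :
  Rbar_le (distance_to (cauchy_kernel 1 0 0) (boundary (disk_image (cauchy_kernel 1 0)))) (1 / 2).
Proof.
  apply (proj1 (Glb_Rbar_correct _)).
  exists (RtoC (1 / 2)). split.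
  - intros eps Heps. split.
    + exists (RtoC (1 / 2 + eps / 2)). split; [apply disk_image_cauchy_kernel; simpl; lra|].
      rewrite <- RtoC_minus, Cmod_R, Rabs_pos_eq; lra.
    + exists (RtoC (1 / 2)). split; [rewrite disk_image_cauchy_kernel; simpl; lra|].
      rewrite <- RtoC_minus, Cmod_R, Rabs_pos_eq; lra.
  - replace (cauchy_kernel 1 0 0 - RtoC (1 / 2))%C with (RtoC (1 / 2)).
    + rewrite Cmod_R, Rabs_pos_eq; lra.
    + unfold cauchy_kernel, Cdiv. rewrite RtoC_div by lra. field.
Qed.

Lemma cauchy_kernel_quasiconformal (K : R) : 1 <= K ->
  let k := RtoC ((K - 1) / (K + 1)) in
  sense_preserving_quasiconformal K
    (fun z => cauchy_kernel 1 0 z + Cconj (cauchy_kernel k (- k) z))%C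
    (cauchy_kernel 1 0) (cauchy_kernel k (- k)).
Proof.
  intros HK k.
  assert (Hk : 0 <= (K - 1) / (K + 1) < 1).
  { split; [apply Rdiv_le_0_compat; lra|].
    apply (Rmult_lt_reg_r (K + 1)); [lra|]. unfold Rdiv. rewrite Rmult_assoc, Rinv_l; lra. }
  assert (Hdil : forall z, unit_disk z ->
    C_derive (cauchy_kernel 1 0) z <> RtoC 0 /\
    Cmod (dilatation (cauchy_kernel 1 0) (cauchy_kernel k (- k)) z) = (K - 1) / (K + 1)).
  { intros z Hz. pose proof (one_minus_neq_0 z Hz) as Hz1.
    unfold dilatation. rewrite !(is_C_derive_unique _ _ _ (is_derive_cauchy_kernel _ _ z Hz)).
    assert (Hd : (1 / (1 - z) ^ 2)%C <> RtoC 0).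
    { intros E. apply C1_nz.
      replace (RtoC 1) with (1 / (1 - z) ^ 2 * (1 - z) ^ 2)%C by (simpl Cpow; field; assumption).
      rewrite E. ring. }
    split; [exact Hd|].
    replace (k / (1 - z) ^ 2 / (1 / (1 - z) ^ 2))%C with k.
    - unfold k. rewrite Cmod_R, Rabs_pos_eq; lra.
    - simpl Cpow. field. repeat split; assumption. }
  split; [|split].
  - split; [apply analytic_cauchy_kernel|split; [apply analytic_cauchy_kernel|reflexivity]].
  - intros z Hz. destruct (Hdil z Hz) as [H1 H2]. split; [assumption|]. rewrite H2. lra.
  - intros z Hz. destruct (Hdil z Hz) as [_ ->]. lra.
Qed.

(** With all coefficients of [h] equal to [1] and those of [g] equal to [k], the left-hand
    side at [z = r] is [3/2 + D(r)], while the right-hand side is at most [1 + 1/2].  A point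
    [r] strictly between [R0] and both [rho] and [1] has [D(r) > 0]. *)
Lemma bohr_inequality_sharp (K t : R) (m : nat) (R0 rho : R) :
  1 <= K -> 0 <= t <= 1 -> (1 <= m)%nat -> D_root K t m R0 -> R0 < rho ->
  ~ bohr_inequality_up_to K t m rho.
Proof.
  intros HK Ht Hm [HR HD] Hrho H.
  set (k := (K - 1) / (K + 1)).
  assert (Hk : 0 <= k) by (apply Rdiv_le_0_compat; lra).
  set (r := (R0 + Rmin rho 1) / 2).
  assert (Hr : R0 < r < 1 /\ r <= rho).
  { unfold r. pose proof (Rmin_l rho 1). pose proof (Rmin_r rho 1).
    assert (R0 < Rmin rho 1) by (apply Rmin_glb_lt; lra). lra. }
  pose proof (D_fun_increasing K t m R0 r HK Ht Hm ltac:(lra) ltac:(lra)) as HDr.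
  rewrite HD, D_fun_split in HDr by lra. fold k in HDr.
  assert (Hr1 : Cmod r = r) by (rewrite Cmod_R, Rabs_pos_eq; lra).
  assert (Hrm : 0 <= r ^ m < 1) by (apply pow_unit_interval; [assumption|lra]).
  assert (Hdisk : unit_disk r) by (unfold unit_disk; lra).
  assert (Hsub : subordinate (cauchy_kernel 1 0) (cauchy_kernel 1 0)).
  { exists (fun z => z). repeat split; auto. apply analytic_id. }
  assert (Hb0 : (k + if Nat.eqb 0 0 then - k else 0)%C = RtoC 0) by (simpl Nat.eqb; cbv iota; ring).
  specialize (H _ _ _ _ _ _ (cauchy_kernel_quasiconformal K HK)
    (power_series_cauchy_kernel 1 0) (power_series_cauchy_kernel k (- k)) Hb0
    convex_function_cauchy_kernel Hsub (RtoC r) r Hdisk Hr1 (proj2 Hr)).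
  cbv beta in H.
  assert (E0 : Cmod (cauchy_kernel 1 0 0) = 1).
  { replace (cauchy_kernel 1 0 0) with (RtoC 1) by (unfold cauchy_kernel; field; apply C1_nz).
    apply Cmod_1. }
  assert (Em : Cmod (cauchy_kernel 1 0 (r ^ m)%C) = 1 + r ^ m / (1 - r ^ m)).
  { unfold cauchy_kernel. rewrite <- RtoC_pow, Cplus_0_r, <- RtoC_minus, <- RtoC_div by lra.
    rewrite Cmod_R, Rabs_pos_eq; [field; lra|]. apply Rdiv_le_0_compat; lra. }
  assert (ES : Series (fun n => (Cmod (1 + if Nat.eqb n 0 then 0 else 0)%C
      + Cmod (k + if Nat.eqb n 0 then - k else 0)%C) * r ^ n)
    = 1 + (1 + k) * (r / (1 - r))).
  { apply is_series_unique.
    apply is_series_ext with (a := fun n => (1 + k) * r ^ n + (if Nat.eqb n 0 then - k else 0)).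
    - intros n. match goal with |- ?x = ?y => change (@eq R x y) end.
      destruct (Nat.eqb_spec n 0) as [->|].
      + replace (k + - k)%C with (RtoC 0) by ring. rewrite Cplus_0_r, Cmod_0, Cmod_1. simpl; ring.
      + rewrite !Cplus_0_r, Cmod_1, Cmod_R, Rabs_pos_eq by assumption. ring.
    - replace (1 + (1 + k) * (r / (1 - r))) with ((1 + k) * / (1 - r) + - k) by (field; lra).
      apply (@is_series_plus R_AbsRing R_NormedModule);
        [|apply (@is_series_single R_AbsRing R_NormedModule)].
      apply (@is_series_scal R_AbsRing R_NormedModule), is_series_geom.
      rewrite Rabs_pos_eq; lra. }
  fold k in H. rewrite E0, Em, ES in H.
  pose proof distance_cauchy_kernel as Hdist.
  destruct (distance_to _ _) as [x| |]; simpl in *; try contradiction. lra.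
Qed.

Theorem theorem2p1 (K t : R) (m : nat)
    (hK : 1 <= K) (ht : 0 <= t <= 1) (hm : (1 <= m)%nat) :
  (exists! r : R, D_root K t m r) /\
  (forall RKmt : R, D_root K t m RKmt ->
     bohr_inequality_up_to K t m (Rmin (1 / 3) RKmt) /\
     (RKmt <= 1 / 3 ->
      forall rho : R, RKmt < rho -> ~ bohr_inequality_up_to K t m rho)).
Proof.
  split; [now apply D_root_unique|].
  intros R0 HR0. split.
  - apply (bohr_inequality_up_to_le K t m _ R0 (Rmin_r _ _)).
    now apply bohr_inequality_holds.
  - intros _ rho Hrho. now apply (bohr_inequality_sharp K t m R0).
Qed.
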